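(* A nonabelian $8$-dimensional nice nilpotent Lie algebra admits a diagonal Ricci-flat metric if and only if it is equivalent to one of the following: (1) $(0,0,-e^{12},e^{13},e^{23},e^{14},e^{15}+e^{24},e^{26}+e^{34})$; (2) $(0,0,0,-e^{12},e^{14},e^{15}+e^{24},e^{16}+e^{25},e^{26}+e^{45})$; (3) $(0,0,0,e^{12},e^{13}+e^{24},e^{14},e^{25}+e^{34},e^{15}+e^{26})$; (4) $(0,0,0,(a-1)e^{12},ae^{13}+e^{24},e^{14}+e^{23},e^{15}+e^{26},e^{16}+e^{25}+e^{34})$ with $a>0$, $a\neq1$; (5) $(0,0,0,(a-1)e^{12},ae^{13}+e^{24},-e^{14}+e^{23},-e^{15}+e^{26},e^{16}+e^{25}+e^{34})$ with $a>0$, $a\neq1$; (6) $(0,0,0,0,e^{14}+e^{23},e^{13}+e^{24},e^{16}+e^{25},e^{15}+e^{26})$; (7) $(0,0,0,0,-e^{14}+e^{23},e^{13}+e^{24},-e^{16}+e^{25},e^{15}+e^{26})$; (8) $(0,0,0,0,(a-1)e^{12},ae^{13},e^{23},e^{17}+e^{26}+e^{35})$ with $a\in\mathbb{R}\setminus\{0,1\}$; (9) $(0,0,0,0,0,e^{12},e^{13},e^{27}+e^{36})$.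
   Context: A nice basis of a real Lie algebra is a basis $\{e_1,\dots,e_n\}$ with dual basis $\{e^i\}$ such that each $[e_i,e_j]$ is a multiple of some $e_h$ and each $e_i\lrcorner\,de^j$ is a multiple of some $e^h$, where $d$ is the Chevalley–Eilenberg differential. The notation $(\omega_1,\dots,\omega_n)$ denotes the Lie algebra with nice basis $e_1,\dots,e_n$ and $de^k=\omega_k$, $e^{ij}=e^i\wedge e^j$. Two nice Lie algebras are equivalent if there is a Lie algebra isomorphism mapping each basis element to a multiple of a basis element. A diagonal metric is a nondegenerate scalar product $\sum g_ie^i\otimes e^i$ in the nice basis (any signature); Ricci-flat means the Ricci tensor of the corresponding left-invariant pseudoriemannian metric vanishes. *)

(* Defs.v *)
From HB Require Import structures.
From mathcomp Require Import all_boot all_order all_algebra.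
From mathcomp Require Import reals.
Set Implicit Arguments. Unset Strict Implicit. Unset Printing Implicit Defensive.
Import Order.TTheory GRing.Theory Num.Theory.
Local Open Scope ring_scope.

(* A real Lie algebra with basis e_0..e_{n-1} is given by structure constants:
   [e_i, e_j] = \sum_k c i j k e_k. *)
Definition sconst (R : realType) (n : nat) := 'I_n -> 'I_n -> 'I_n -> R.

Section Defs.
Variables (R : realType) (n : nat).

Definition is_lie (c : sconst R n) : Prop :=
  (forall i k, c i i k = 0) /\
  (forall i j k, c i j k = - c j i k) /\
  (forall i j k l,
     \sum_m (c j k m * c i m l + c k i m * c j m l + c i j m * c k m l) = 0).

(* Nice basis: every [e_i,e_j] is a multiple of some e_h, and every
   e_i _| de^j is a multiple of some e^h, where de^j(x,y) = - e^j([x,y]),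
   so (e_i _| de^j)(e_k) = - c i k j. *)
Definition nice (c : sconst R n) : Prop :=
  (forall i j, exists h, forall k, k != h -> c i j k = 0) /\
  (forall i j, exists h, forall k, k != h -> c i k j = 0).

Definition ad (c : sconst R n) (i : 'I_n) : 'M[R]_n := \matrix_(k, j) c i j k.

(* Nilpotent: the lower central series vanishes, i.e. for some N every
   iterated bracket ad(e_{i1}) ... ad(e_{iN}) (which span g^{N+1}) is zero. *)
Definition nilpotent (c : sconst R n) : Prop :=
  exists N : nat, forall s : N.-tuple 'I_n,
    foldr (fun i M => ad c i *m M) 1%:M s = 0.

Definition abelian (c : sconst R n) : Prop := forall i j k, c i j k = 0.

(* Equivalence: a Lie algebra isomorphism f (matrix, column j = f(e_j))
   from (c) to (d) mapping each basis element to a multiple of a basis element. *)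
Definition nice_equiv (c d : sconst R n) : Prop :=
  exists f : 'M[R]_n,
    f \in unitmx /\
    (forall j, exists h, forall k, k != h -> f k j = 0) /\
    (forall i j k,
       \sum_m f k m * c i j m = \sum_p \sum_q f p i * f q j * d p q k).

(* Levi-Civita connection of the left-invariant metric sum_i g_i e^i (x) e^i:
   nabla_{e_i} e_j = \sum_k Gamma i j k e_k (Koszul formula). *)
Definition Gamma (g : 'I_n -> R) (c : sconst R n) (i j k : 'I_n) : R :=
  (g k * c i j k - g i * c j k i + g j * c k i j) / (2 * g k).

(* Ricci tensor ric(e_j, e_l) = trace (X |-> R(X,e_j) e_l), with
   R(X,Y)Z = nabla_X nabla_Y Z - nabla_Y nabla_X Z - nabla_[X,Y] Z. *)
Definition ricci (g : 'I_n -> R) (c : sconst R n) (j l : 'I_n) : R :=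
  \sum_i (\sum_m (Gamma g c j l m * Gamma g c i m i
                  - Gamma g c i l m * Gamma g c j m i
                  - c i j m * Gamma g c m l i)).

Definition diag_ricci_flat (c : sconst R n) : Prop :=
  exists g : 'I_n -> R, (forall i, g i != 0) /\ (forall j l, ricci g c j l = 0).

(* Building a Lie algebra from the paper's notation (w_1,...,w_n), de^k = w_k.
   An entry (a, i, j, k) (1-based indices, i<j) means that de^k contains a e^{ij}.
   Since de^k(e_i,e_j) = - e^k([e_i,e_j]), this gives c i j k = -a, c j i k = a. *)
Definition of_forms (l : seq (R * nat * nat * nat)) : sconst R n :=
  fun p q r =>
    - \sum_(t <- l)
        (if t.2 == r.+1 then
           (if (t.1.1.2 == p.+1) && (t.1.2 == q.+1) then t.1.1.1
            else if (t.1.1.2 == q.+1) && (t.1.2 == p.+1) then - t.1.1.1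
            else 0)
         else 0).

End Defs.

Section Algebras.
Variable R : realType.
Local Notation LA l := (@of_forms R 8 l).

Definition LA1 : sconst R 8 := LA
  [:: (-1,1,2,3); (1,1,3,4); (1,2,3,5); (1,1,4,6); (1,1,5,7); (1,2,4,7);
      (1,2,6,8); (1,3,4,8)].
Definition LA2 : sconst R 8 := LA
  [:: (-1,1,2,4); (1,1,4,5); (1,1,5,6); (1,2,4,6); (1,1,6,7); (1,2,5,7);
      (1,2,6,8); (1,4,5,8)].
Definition LA3 : sconst R 8 := LA
  [:: (1,1,2,4); (1,1,3,5); (1,2,4,5); (1,1,4,6); (1,2,5,7); (1,3,4,7);
      (1,1,5,8); (1,2,6,8)].
Definition LA4 (a : R) : sconst R 8 := LA
  [:: (a - 1,1,2,4); (a,1,3,5); (1,2,4,5); (1,1,4,6); (1,2,3,6); (1,1,5,7);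
      (1,2,6,7); (1,1,6,8); (1,2,5,8); (1,3,4,8)].
Definition LA5 (a : R) : sconst R 8 := LA
  [:: (a - 1,1,2,4); (a,1,3,5); (1,2,4,5); (-1,1,4,6); (1,2,3,6); (-1,1,5,7);
      (1,2,6,7); (1,1,6,8); (1,2,5,8); (1,3,4,8)].
Definition LA6 : sconst R 8 := LA
  [:: (1,1,4,5); (1,2,3,5); (1,1,3,6); (1,2,4,6); (1,1,6,7); (1,2,5,7);
      (1,1,5,8); (1,2,6,8)].
Definition LA7 : sconst R 8 := LA
  [:: (-1,1,4,5); (1,2,3,5); (1,1,3,6); (1,2,4,6); (-1,1,6,7); (1,2,5,7);
      (1,1,5,8); (1,2,6,8)].
Definition LA8 (a : R) : sconst R 8 := LA
  [:: (a - 1,1,2,5); (a,1,3,6); (1,2,3,7); (1,1,7,8); (1,2,6,8); (1,3,5,8)].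
Definition LA9 : sconst R 8 := LA
  [:: (1,1,2,6); (1,1,3,7); (1,2,7,8); (1,3,6,8)].

End Algebras.

(* Main.v *)
From mathcomp Require Import all_fingroup boolp ring lra zify.
Require Import Defs.
From HB Require Import structures.
From mathcomp Require Import all_boot all_order all_algebra.
From mathcomp Require Import reals.

(** In a nice basis e_1, ..., e_n of a nilpotent Lie algebra the Ricci tensor of
    a diagonal metric g is diagonal.  Put X_(ij,k) = c_ijk^2 g_k / (g_i g_j) for
    each nonzero structure constant ("arrow" ij -> k).  Ricci-flatness says that
    at every node the weights of the incoming arrows and those of the outgoing
    arrows have the same sum.  Equivalently, for all real numbers w_1, ..., w_n
    the sum of (w_k - w_i - w_j) X_(ij,k) over all arrows is zero.  In particular
    no w may satisfy w_k = w_i + w_j at all arrows but one.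

    Since c is nilpotent, the basis can be ordered so that i, j < k at every
    arrow; among these orders take one that is lexicographically minimal for
    numerical codes of the sets of arrows into each node.  The possible arrow
    diagrams are then few enough to be listed by computation.  Nearly all of them
    are isolated by such a w.  Most of the others are impossible because a Jacobi
    identity with two terms gives an equation X_a X_b = X_c X_d which, together
    with the linear equations, forces some product X_p X_q to vanish.  Fourteen
    diagrams are left.  Seven are excluded by hand: by signs of products of
    weights, by the Jacobi identities alone, or by a computation that mixes both.
    On the other seven the basis can be rescaled to one of the nine families;
    conversely explicit metrics show that these are Ricci-flat. *)

Set Implicit Arguments. Unset Strict Implicit. Unset Printing Implicit Defensive.

(** * Enumeration of the diagrams *)

(* The arrow [(i, j, k)], with [i < j] and nodes counted from 0, means that
   [e_i, e_j] has a nonzero component along e_k. *)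
Notation arrow := (nat * nat * nat)%type.

(* Unlike [has], [all] and [&&], these are short-circuiting under call by value. *)
Notation "a &&& b" := (if a then b else false)
  (at level 40, b at level 41, left associativity).
Notation "a ||| b" := (if a then true else b)
  (at level 50, left associativity).

Section Short.
Variables (T : Type) (p : T -> bool).
Fixpoint every (s : seq T) : bool := if s is x :: s' then p x &&& every s' else true.
Fixpoint some (s : seq T) : bool := if s is x :: s' then p x ||| some s' else false.
End Short.

Definition arrow_eq (a b : arrow) : bool :=
  let: (i, j, k) := a in let: (i', j', k') := b in
  eqn k k' &&& eqn i i' &&& eqn j j'.

Definition norm (i j k : nat) : arrow := if i < j then (i, j, k) else (j, i, k).

Definition map_arrow (q : nat -> nat) (a : arrow) : arrow :=
  norm (q a.1.1) (q a.1.2) (q a.2).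

Fixpoint pairs k : seq (nat * nat) :=
  if k is j.+1 then pairs j ++ [seq (i, j) | i <- iota 0 j] else [::].

Definition disj (p q : nat * nat) : bool :=
  let: (i, j) := p in let: (i', j') := q in
  if eqn i i' then false else if eqn i j' then false else
  if eqn j i' then false else ~~ eqn j j'.

(** In a nice basis two arrows into the same node have disjoint sources, so the arrows into a new
    node form a matching of the earlier nodes. The fuel bounds the length of [l]. *)
Fixpoint matchings (fuel : nat) (l : seq (nat * nat)) : seq (seq (nat * nat)) :=
  if fuel is f.+1 then
    if l is p :: r then
      matchings f r ++ [seq p :: m | m <- matchings f (filter (disj p) r)]
    else [:: [::]]
  else [:: [::]].

Definition all_matchings l := matchings (size l) l.

Definition touches (v : nat) (a : arrow) : bool :=
  let: (i, j, k) := a in eqn i v ||| eqn j v ||| eqn k v.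

(** A node on exactly one arrow is impossible: the w that is 1 there and 0 elsewhere isolates that
    arrow. *)
Definition no_leaf (D : seq arrow) : bool :=
  every (fun v => ~~ eqn (count (touches v) D) 1) (iota 0 8).

Definition joins (m n : nat) (e : arrow) : bool :=
  let: (i, j, _) := e in (eqn i m &&& eqn j n) ||| (eqn i n &&& eqn j m).

(* If [(i, j)] has an arrow to m and [(m, r)] one to k, then the component along
   e_k of the Jacobi identity for e_i, e_j, e_r needs a second nonzero term. *)
Definition companion (D : seq arrow) i j r k : bool :=
  some (fun e : arrow =>
    (joins j r e &&& some (arrow_eq (norm i e.2 k)) D)
    ||| (joins i r e &&& some (arrow_eq (norm j e.2 k)) D)) D.

Definition jacobi_ok (k : nat) (D : seq arrow) : bool :=
  let chk m r := every (fun e : arrow => let: (i, j, m') := e in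
     ~~ eqn m' m ||| companion D i j r k) D in
  every (fun a : arrow => let: (m, r, k') := a in
    ~~ eqn k' k ||| (chk m r &&& chk r m)) D.

Fixpoint lexle (s t : seq nat) : bool :=
  match s, t with
  | x :: s', y :: t' => if eqn x y then lexle s' t' else x <= y
  | [::], _ => true
  | _ :: _, [::] => false
  end.

Definition swap p v := if eqn v p then p.+1 else if eqn v p.+1 then p else v.

(* The codes of the nodes up to k after the relabelling q.  The weight of an arrow
   is symmetric in its two sources and prunes well; any other would be sound. *)
Definition codes (k : nat) (q : nat -> nat) (D : seq arrow) : seq nat :=
  [seq sumn [seq (let: (i, j, k') := a in
                  if eqn (q k') v then ((q i).+1 * (q j).+1).*2 else 0) | a <- D]
     | v <- iota 0 k.+1].

Definition into p v (a : arrow) : bool :=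
  let: (i, j, k) := a in eqn k v &&& (eqn i p ||| eqn j p).

(* Transposing adjacent nodes p and p+1 keeps the order topological unless there
   is an arrow from p to p+1. *)
Definition lex_ok (k : nat) (D : seq arrow) : bool :=
  every (fun p => some (into p p.+1) D
      ||| lexle (codes k id D) (codes k (swap p) D)) (iota 0 k).

(** The Jacobi condition along e_k and the codes up to k only involve arrows into nodes up to k, so
    they can prune as soon as node k is placed. Leaves can only be recognized once all eight nodes
    are present. *)
Definition admissible (k : nat) (D : seq arrow) : bool :=
  ((k < 7) ||| no_leaf D) &&& jacobi_ok k D &&& lex_ok k D.

(** A bracket has at most one nonzero component, so a pair that is the source of an arrow cannot be
    used again. *)
Definition free (D : seq arrow) (p : nat * nat) : bool :=
  let: (i, j) := p in
  every (fun a : arrow => let: (i', j', _) := a in ~~ (eqn i i' &&& eqn j j')) D.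

Fixpoint search (k : nat) : seq (seq arrow) :=
  if k is l.+1 then
    filter (admissible l) (flatten [seq
      [seq D ++ [seq (p, l) | p <- m]
         | m <- all_matchings (filter (free D) (pairs l))] | D <- search l])
  else [:: [::]].

Lemma everyE T p (s : seq T) : every p s = all p s.
Proof. by elim: s => //= x s ->. Qed.

Lemma someE T p (s : seq T) : some p s = has p s.
Proof. by elim: s => //= x s ->. Qed.

Lemma arrow_eqE a b : arrow_eq a b = (a == b).
Proof.
case: a b => [[i j] k] [[i' j'] k']; rewrite /= !eqnE !xpair_eqE [RHS]andbC.
by case: (k == k'); case: (i == i').
Qed.

Lemma some_mem a D : some (arrow_eq a) D = (a \in D).
Proof.
by rewrite someE -has_pred1; apply: eq_has => x; rewrite arrow_eqE eq_sym.
Qed.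

Lemma disjE p q :
  disj p q = [&& p.1 != q.1, p.1 != q.2, p.2 != q.1 & p.2 != q.2].
Proof.
case: p q => i j [i' j'] /=; rewrite !eqnE.
by case: (i == i'); case: (i == j'); case: (j == i').
Qed.

Lemma mem_pairs i j k : ((i, j) \in pairs k) = (i < j < k).
Proof.
elim: k => [|k IH] /=; first by rewrite ltn0 andbF.
rewrite mem_cat IH ltnS (leq_eqVlt j k) andb_orr orbC; congr (_ || _).
apply/mapP/andP => [[x]|[ij /eqP jk]].
  by rewrite mem_iota => /andP[_ +] [-> ->]; rewrite eqxx.
by exists i; rewrite ?jk // mem_iota -jk.
Qed.

Lemma uniq_pairs k : uniq (pairs k).
Proof.
elim: k => //= k IH; rewrite cat_uniq IH map_inj_uniq ?iota_uniq => [|x y [] //].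
rewrite andbT /=; apply/hasPn => -[i j] /mapP[x _ [_ ->]].
by rewrite mem_pairs ltnn andbF.
Qed.

(** The enumeration keeps the order of [l], so a matching is found literally as a filtered list and
    no permutation enters. *)
Lemma matchingsP f l (P : pred (nat * nat)) : size l <= f ->
  pairwise disj (filter P l) -> filter P l \in matchings f l.
Proof.
elim: f l => [|f IH] [|p r] //=; rewrite ltnS => sr.
rewrite mem_cat; case: ifP => [Pp|nPp] /=; last by move=> /(IH _ sr) ->.
move=> /andP[/allP dp pw]; apply/orP; right.
have E : filter P r = filter P (filter (disj p) r).
  rewrite -filter_predI; apply: eq_in_filter => q qr /=.
  by case Pq : (P q) => //=; rewrite dp // mem_filter Pq.
rewrite E; apply: map_f; apply: IH; last by rewrite -E.
by rewrite size_filter (leq_trans (count_size _ _)).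
Qed.

(** Lexicographic inequalities pass to prefixes; thus minimality of the complete diagram may be used
    to prune partial ones. *)
Lemma take_lexle n s t : lexle s t -> lexle (take n s) (take n t).
Proof.
elim: s t n => [|x s IH] [|y t] [|n] //=.
by case: (eqn x y) => //; apply: IH.
Qed.

Lemma take_codes k l q D : k <= l ->
  take k.+1 (codes l q D) = codes k q D.
Proof. by move=> kl; rewrite /codes -map_take take_iota (minn_idPl _). Qed.

Lemma swapK p : involutive (swap p).
Proof.
move=> v; rewrite /swap !eqnE; case: (eqVneq v p) => [->|vp].
  by rewrite eqn_leq ltnn eqxx.
by case: (eqVneq v p.+1) => [->|vp']; rewrite ?eqxx // (negbTE vp) (negbTE vp').
Qed.

Lemma searchS l : search l.+1 =
  filter (admissible l) (flatten [seq
      [seq D ++ [seq (p, l) | p <- m]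
         | m <- all_matchings (filter (free D) (pairs l))] | D <- search l]).
Proof. by []. Qed.

(** * Completeness of the search *)

Section Soundness.
Variable b : nat -> nat -> nat -> bool.
Hypothesis b_sym : forall i j k, b i j k = b j i k.
Hypothesis b_tri : forall i j k, b i j k -> [&& i != j, i < k & j < k].
Hypothesis b_out : forall i j k k', b i j k -> b i j k' -> k = k'.
Hypothesis b_in : forall i j j' k, b i j k -> b i j' k -> j = j'.
Hypothesis b_jacobi : forall i j m r k, b i j m -> b m r k ->
  (exists2 m', b j r m' & b i m' k) \/ (exists2 m', b i r m' & b j m' k).

Definition level_arrows k : seq arrow := [seq (p, k) | p <- pairs k & b p.1 p.2 k].
Definition diagram k : seq arrow := flatten [seq level_arrows l | l <- iota 0 k].

Hypothesis b_leaf : no_leaf (diagram 8).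
Hypothesis b_lex : forall p, p < 7 -> (forall i, ~~ b p i p.+1) ->
  lexle (codes 7 id (diagram 8)) (codes 7 (swap p) (diagram 8)).

Lemma diagramS k : diagram k.+1 = diagram k ++ level_arrows k.
Proof. by rewrite /diagram -addn1 iotaD map_cat flatten_cat /= cats0. Qed.

Lemma mem_diagram i j k l : ((i, j, k) \in diagram l) = [&& i < j, k < l & b i j k].
Proof.
elim: l => [|l IH]; first by rewrite ltn0 andbF.
rewrite diagramS mem_cat IH (ltnS k) (leq_eqVlt k) andb_orl andb_orr orbC.
congr (_ || _); apply/mapP/idP => [[p]|].
  rewrite mem_filter => /andP[+ +] [ep ->]; rewrite -ep mem_pairs eqxx /= => -> /andP[-> _].
  by [].
move=> /and3P[ij /eqP <- bijk]; exists (i, j) => //.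
by rewrite mem_filter /= bijk mem_pairs ij; case/and3P: (b_tri bijk).
Qed.

Lemma uniq_diagram l : uniq (diagram l).
Proof.
elim: l => // l IH; rewrite diagramS cat_uniq IH /=; apply/andP; split.
  apply/hasPn => -[[i j] k] /mapP[p _ [_ ->]].
  by rewrite /= mem_diagram ltnn andbF.
by rewrite map_inj_uniq ?filter_uniq ?uniq_pairs // => p q [].
Qed.

Lemma mem_norm i j k l : (norm i j k \in diagram l) = (k < l) && b i j k.
Proof.
rewrite /norm; case: ltngtP => [ij|ij|->]; rewrite mem_diagram.
- by rewrite ij.
- by rewrite ij b_sym.
- rewrite ltnn /=; apply/esym/negbTE/negP => /andP[_ /b_tri].
  by rewrite eqxx.
Qed.

Lemma diagram_cat k l : k <= l -> exists2 E, diagram l = diagram k ++ E &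
  all (fun a : arrow => k <= a.2) E.
Proof.
move=> kl; exists (flatten [seq level_arrows v | v <- iota k (l - k)]).
  by rewrite /diagram -{1}(subnKC kl) iotaD map_cat flatten_cat.
apply/allP => -[[i j] m] /flatten_mapP[v]; rewrite mem_iota => /andP[kv _].
by case/mapP => p _ [_ ->].
Qed.

(** Arrows into nodes after k do not contribute to the first codes, as long as [q] moves none of
    these nodes down to k or below. *)
Lemma codes_diagram k q : k < 8 -> (forall v, k < v -> k < q v) ->
  codes k q (diagram 8) = codes k q (diagram k.+1).
Proof.
move=> k8 qP; have [E -> /allP EP] := diagram_cat k8.
apply/eq_in_map => v; rewrite mem_iota => /andP[_ vk].
rewrite map_cat sumn_cat -[RHS]addn0; congr (_ + _).
elim: E EP => //= -[[i j] m] E IH EP; rewrite IH => [|a aE];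
  last by rewrite EP ?inE ?aE ?orbT.
rewrite eqnE gtn_eqF // (leq_trans vk) // qP //.
by have /= := EP _ (mem_head _ _).
Qed.

Lemma lex_ok_diagram k : k < 8 -> lex_ok k (diagram k.+1).
Proof.
move=> k8; rewrite /lex_ok everyE; apply/allP => p; rewrite mem_iota => /andP[_ pk].
rewrite someE; case: hasP => //= nh.
have p7 : p < 7 by rewrite add0n in pk; lia.
have nb i : ~~ b p i p.+1.
  apply/negP => bpi; case: nh.
  have : norm p i p.+1 \in diagram k.+1 by rewrite mem_norm bpi ltnS pk.
  move=> h; exists (norm p i p.+1) => //.
  by rewrite /norm; case: ifP => _ /=; rewrite !eqnE !eqxx ?orbT //; case: (i == p).
have := take_lexle k.+1 (b_lex p7 nb).
rewrite !take_codes // !codes_diagram // => v kv.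
by rewrite /swap !eqnE; case: eqVneq => [|_]; [lia | case: eqVneq => // ?; lia].
Qed.

Lemma jacobi_ok_diagram k : jacobi_ok k (diagram k.+1).
Proof.
rewrite /jacobi_ok everyE.
have chk m r : b m r k -> every (fun e : arrow => let: (i, j, m') := e in
     ~~ eqn m' m ||| companion (diagram k.+1) i j r k)
     (diagram k.+1).
  move=> bmrk; rewrite everyE; apply/allP => -[[i j] m'].
  rewrite mem_diagram => /and3P[ij mk bijm] /=; rewrite !eqnE.
  case: eqVneq => // em; rewrite {}em in mk bijm.
  have sub m1 x y z : b x y m1 -> b z m1 k -> norm x y m1 \in diagram k.+1.
    move=> bx bz; rewrite mem_norm bx andbT.
    by case/and3P: (b_tri bz) => _ _ /ltnW.
  rewrite /companion someE; apply/hasP.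
  have jn x y z : joins x y (norm x y z).
    by rewrite /norm; case: ifP => _; rewrite /joins !eqnE !eqxx //=; case: ifP.
  have n2 x y z : (norm x y z).2 = z by rewrite /norm; case: ifP.
  case: (b_jacobi bijm bmrk) => -[m1 b1 b2].
    exists (norm j r m1); first exact: sub b1 b2.
    by rewrite jn n2 /= some_mem mem_norm ltnSn b2.
  exists (norm i r m1); first exact: sub b1 b2.
  by rewrite jn n2 /= !some_mem !mem_norm ltnSn b2; case: ifP.
apply/allP => -[[m r] k']; rewrite mem_diagram => /and3P[_ _ bmr].
rewrite eqnE; case: eqVneq => //= ek; rewrite {}ek in bmr.
by rewrite chk //= chk // b_sym.
Qed.

Lemma diagram_search k : k <= 8 -> diagram k \in search k.
Proof.
elim: k => [|k IH] k8; first by rewrite inE.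
have ks := IH (ltnW k8).
rewrite searchS mem_filter; apply/andP; split.
  rewrite /admissible jacobi_ok_diagram lex_ok_diagram //.
  by case: ltnP => // k7; rewrite (_ : k = 7) ?b_leaf //; apply/eqP;
    rewrite eqn_leq k7 andbT.
apply/flatten_mapP; exists (diagram k) => //; rewrite diagramS.
pose m := [seq p <- pairs k | b p.1 p.2 k].
apply: (map_f (fun m => diagram k ++ [seq (p, k) | p <- m]) (_ : m \in _)).
(* By [b_out] a pair with an arrow to k has none to an earlier node, so restricting to free pairs
   loses nothing. *)
have -> : m = [seq p <- filter (free (diagram k)) (pairs k) | b p.1 p.2 k].
  rewrite -filter_predI; apply: eq_filter => -[i j] /=.
  case bk : (b i j k) => //=; apply/esym; rewrite everyE; apply/allP => -[[i' j'] k'].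
  rewrite mem_diagram => /and3P[_ kk' b']; rewrite !eqnE.
  case: eqVneq => // ei; case: eqVneq => //= ej; rewrite -ei -ej in b'.
  by rewrite (b_out bk b') ltnn in kk'.
apply: matchingsP => //.
set s := [seq p <- _ | _].
have := filter_uniq (fun p => b p.1 p.2 k) (filter_uniq (free (diagram k)) (uniq_pairs k)).
(* Two pairs with an arrow to k that share a node coincide by [b_in]; the condition i < j rules out
   the crossed cases. *)
rewrite -/s uniq_pairwise; apply: (@sub_in_pairwise _ (fun p => (p.1 < p.2) && b p.1 p.2
  k)).
  move=> p q pP qP ne; rewrite disjE; move: pP qP ne.
  case: p q => i j [i' j'] /= /andP[/= ij bij] /andP[/= ij' bij'] ne.
  apply/and4P; split; apply: contraNneq ne => e; move: bij ij bij' ij'; rewrite e.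
  - by move=> bij1 _ bij2 _; rewrite (b_in bij1 bij2).
  - move=> bij1 ij1; rewrite b_sym => bij2 ij2.
    by have := ltn_trans ij2 ij1; rewrite (b_in bij1 bij2) ltnn.
  - rewrite b_sym => bij1 ij1 bij2 ij2.
    by have := ltn_trans ij1 ij2; rewrite (b_in bij1 bij2) ltnn.
  - by rewrite b_sym => bij1 _; rewrite b_sym => bij2 _; rewrite (b_in bij1 bij2).
by apply/allP => -[i j]; rewrite !mem_filter mem_pairs => /and3P[-> _ /andP[->]].
Qed.
End Soundness.

(** * Diagrams without a Ricci-flat metric *)

(* A grading [(t, l)] gives node v the weight [l_v - t], so that negative weights
   can be written with natural numbers. *)
Definition neutral (w : nat * seq nat) (a : arrow) : bool :=
  let: (i, j, k) := a in
  eqn (nth 0 w.2 k + w.1) (nth 0 w.2 i + nth 0 w.2 j).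

(** The graded sum of the weights then reduces to a single term, so that a nonzero weight would have
    to vanish. *)
Definition isolates (D : seq arrow) (w : nat * seq nat) : bool :=
  eqn (count (fun a => ~~ neutral w a) D) 1.

(** This is w_k - w_i - w_j for w_v = l_v - t; two of the three shifts cancel and t remains on the
    side of k. *)
Definition defect (w : nat * seq nat) (a : arrow) : int :=
  let: (i, j, k) := a in
  ((nth 0 w.2 k + w.1)%N%:Z - (nth 0 w.2 i + nth 0 w.2 j)%N%:Z)%R.

(* A certificate is a linear combination of products X_a * (sum of defect w b * X_b)
   and of quadratic relations X_a X_b - X_c X_d coming from two-term Jacobi
   identities, which equals a nonzero multiple of the product of two weights. *)
Record certificate := Certificate {
  target1 : arrow; target2 : arrow;
  linear_part : seq (arrow * (nat * seq nat));
  jacobi_part : seq (int * arrow * arrow) }.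

(** Here [x] and [y] are not arrows: [x] holds the three vectors of a Jacobi identity, [y] the
    intermediate nodes m, m' of its two nonzero terms and the component l. The last conjunct says
    that the term through the bracket of e_k and e_i is absent. *)
Definition jacobi_pair (D : seq arrow) (x y : arrow) : bool :=
  let: (i, j, k) := x in let: (m, m', l) := y in
  [&& norm i j m \in D, norm k m l \in D, norm j k m' \in D, norm i m' l \in D &
      all (fun e : arrow => ~~ (joins k i e && (norm j e.2 l \in D))) D].

Definition same_pair (t t' : int * arrow * arrow) : bool :=
  (arrow_eq t.1.2 t'.1.2 &&& arrow_eq t.2 t'.2)
  ||| (arrow_eq t.1.2 t'.2 &&& arrow_eq t.2 t'.1.2).

Definition coef_sum (L : seq (int * arrow * arrow)) : int :=
  foldr (fun t s => t.1.1 + s)%R 0%R L.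

(** Tests whether a quadratic form is zero by collecting like monomials one at a time. *)
Fixpoint vanishes (fuel : nat) (L : seq (int * arrow * arrow)) : bool :=
  if fuel is f.+1 then
    if L is t :: _ then
      (coef_sum (filter (same_pair t) L) == 0%R) &&
      vanishes f (filter (fun t' => ~~ same_pair t t') L)
    else true
  else false.

Definition terms (D : seq arrow) (C : certificate) : seq (int * arrow * arrow) :=
  flatten [seq [seq (defect p.2 a, p.1, a) | a <- D] | p <- linear_part C] ++
  flatten [seq (let: (q, (i, j, k), (m, m', l)) := t in
      [:: (q, norm i j m, norm k m l); (- q, norm j k m', norm i m' l)%R])
    | t <- jacobi_part C].

(** In the expanded combination all monomials cancel except the target, which is a product of two
    nonzero weights; [t0] only carries the target pair. *)
Definition refutes (D : seq arrow) (C : certificate) : bool :=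
  let t0 := (0%R : int, target1 C, target2 C) in
  let L := terms D C in
  [&& target1 C \in D, target2 C \in D,
      all (fun t => jacobi_pair D t.1.2 t.2) (jacobi_part C),
      coef_sum (filter (same_pair t0) L) != 0%R &
      vanishes (size L).+1 (filter (fun t => ~~ same_pair t0 t) L)].

Definition survives (D : seq arrow) (e : seq arrow * seq nat) : bool :=
  perm_eq (iota 0 8) e.2 && perm_eq (map (map_arrow (nth 0 e.2)) D) e.1.

(* [D1], ..., [D9] are the diagrams of [LA1], ..., [LA9]; [LA5] shares [D4] and
   [LA7] shares [D6].  [E1], ..., [E7] are excluded by separate arguments. *)
Definition D1 : seq arrow :=
  [:: (0, 1, 2); (0, 2, 3); (1, 2, 4); (0, 3, 5); (0, 4, 6); (1, 3, 6); (1, 5, 7); (2,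
      3, 7)].

Definition D2 : seq arrow :=
  [:: (0, 1, 3); (0, 3, 4); (0, 4, 5); (1, 3, 5); (0, 5, 6); (1, 4, 6); (1, 5, 7); (3,
      4, 7)].

Definition D3 : seq arrow :=
  [:: (0, 1, 3); (0, 2, 4); (1, 3, 4); (0, 3, 5); (1, 4, 6); (2, 3, 6); (0, 4, 7); (1,
      5, 7)].

Definition D4 : seq arrow :=
  [:: (0, 1, 3); (0, 2, 4); (1, 3, 4); (0, 3, 5); (1, 2, 5); (0, 4, 6); (1, 5, 6); (0,
      5, 7); (1, 4, 7); (2, 3, 7)].

Definition D6 : seq arrow :=
  [:: (0, 3, 4); (1, 2, 4); (0, 2, 5); (1, 3, 5); (0, 5, 6); (1, 4, 6); (0, 4, 7); (1,
      5, 7)].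

Definition D8 : seq arrow :=
  [:: (0, 1, 4); (0, 2, 5); (1, 2, 6); (0, 6, 7); (1, 5, 7); (2, 4, 7)].

Definition D9 : seq arrow :=
  [:: (0, 1, 5); (0, 2, 6); (1, 6, 7); (2, 5, 7)].

Definition E1 : seq arrow :=
  [:: (0, 1, 4); (0, 2, 5); (0, 4, 6); (1, 3, 6); (0, 5, 7); (2, 3, 7)].

Definition E2 : seq arrow :=
  [:: (0, 1, 4); (0, 2, 5); (1, 5, 6); (2, 4, 6); (0, 6, 7); (4, 5, 7)].

Definition E3 : seq arrow :=
  [:: (0, 1, 4); (0, 4, 5); (1, 2, 5); (0, 3, 6); (1, 4, 6); (0, 6, 7); (1, 5, 7); (2,
      3, 7)].

Definition E4 : seq arrow :=
  [:: (0, 1, 3); (0, 2, 4); (1, 2, 5); (0, 3, 6); (1, 5, 6); (2, 4, 6); (0, 4, 7); (1,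
      3, 7); (2, 5, 7)].

Definition E5 : seq arrow :=
  [:: (0, 1, 2); (0, 2, 3); (0, 3, 4); (1, 2, 4); (0, 4, 5); (1, 3, 5); (1, 4, 6); (2,
      3, 6); (0, 6, 7); (2, 4, 7)].

Definition E6 : seq arrow :=
  [:: (0, 1, 3); (0, 2, 4); (0, 3, 5); (1, 2, 5); (0, 5, 6); (1, 4, 6); (2, 3, 6); (0,
      6, 7); (2, 5, 7); (3, 4, 7)].

Definition E7 : seq arrow :=
  [:: (0, 1, 2); (0, 2, 3); (0, 3, 4); (1, 2, 4); (0, 4, 5); (1, 3, 5); (0, 5, 6); (1,
      4, 6); (2, 3, 6); (0, 6, 7); (1, 5, 7); (2, 4, 7)].

Definition gradings : seq (nat * seq nat) := [::
  (0, [:: 1; 1; 2; 2; 3; 3; 4; 5]);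
  (0, [:: 1; 0; 0; 1; 1; 0; 1; 1]);
  (1, [:: 1; 1; 0; 1; 0; 0; 0; 0]);
  (1, [:: 1; 1; 0; 0; 0; 0; 0; 0]);
  (0, [:: 0; 1; 0; 1; 1; 1; 1; 1]);
  (1, [:: 1; 0; 1; 0; 0; 1; 0; 0]);
  (0, [:: 1; 0; 0; 1; 1; 1; 1; 1]);
  (1, [:: 0; 1; 0; 1; 0; 1; 0; 0]);
  (0, [:: 1; 2; 1; 2; 3; 3; 4; 5]);
  (0, [:: 1; 0; 0; 0; 1; 1; 0; 1]);
  (1, [:: 1; 0; 1; 0; 1; 0; 1; 0]);
  (1, [:: 1; 0; 1; 0; 1; 0; 0; 0]);
  (0, [:: 1; 0; 0; 1; 0; 1; 1; 1]);
  (0, [:: 0; 0; 1; 0; 1; 1; 0; 1]);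
  (0, [:: 1; 1; 0; 0; 0; 1; 1; 1]);
  (0, [:: 1; 2; 3; 4; 5; 6; 7; 8]);
  (1, [:: 0; 2; 2; 1; 1; 0; 2; 1]);
  (1, [:: 1; 1; 1; 0; 0; 0; 0; 0]);
  (1, [:: 2; 1; 0; 2; 1; 0; 1; 2]);
  (1, [:: 1; 0; 1; 0; 0; 0; 1; 0]);
  (1, [:: 0; 1; 0; 1; 0; 0; 0; 0]);
  (0, [:: 1; 2; 3; 3; 4; 5; 5; 7]);
  (1, [:: 1; 2; 1; 0; 1; 1; 1; 1]);
  (1, [:: 1; 0; 2; 0; 2; 1; 1; 0]);
  (1, [:: 1; 0; 1; 0; 1; 0; 0; 1]);
  (0, [:: 0; 0; 1; 1; 0; 1; 1; 1]);
  (2, [:: 1; 0; 3; 4; 2; 1; 3; 2]);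
  (0, [:: 0; 1; 0; 1; 2; 1; 2; 2]);
  (5, [:: 6; 3; 0; 7; 4; 1; 2; 5]);
  (0, [:: 2; 1; 2; 1; 3; 3; 5; 4]);
  (1, [:: 1; 1; 2; 1; 0; 1; 1; 1]);
  (1, [:: 0; 2; 1; 0; 2; 1; 0; 1]);
  (1, [:: 0; 2; 2; 1; 1; 2; 1; 2]);
  (1, [:: 2; 0; 1; 0; 1; 2; 1; 2]);
  (1, [:: 1; 0; 2; 0; 0; 2; 1; 2]);
  (1, [:: 2; 0; 1; 1; 2; 0; 2; 2]);
  (2, [:: 1; 4; 0; 3; 3; 2; 1; 2]);
  (3, [:: 1; 6; 4; 2; 0; 7; 5; 3]);
  (4, [:: 6; 1; 3; 5; 0; 2; 7; 4]);
  (5, [:: 4; 3; 2; 2; 1; 3; 1; 0]);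
  (0, [:: 0; 0; 1; 0; 0; 1; 0; 0]);
  (0, [:: 0; 0; 1; 0; 1; 0; 1; 0]);
  (1, [:: 2; 1; 1; 2; 0; 1; 1; 1]);
  (0, [:: 0; 0; 1; 0; 1; 1; 1; 0]);
  (1, [:: 1; 2; 1; 0; 0; 1; 1; 0]);
  (1, [:: 0; 1; 1; 0; 0; 1; 1; 0]);
  (1, [:: 1; 1; 0; 0; 0; 0; 1; 0]);
  (1, [:: 1; 2; 0; 1; 2; 0; 0; 1]);
  (1, [:: 0; 0; 1; 1; 0; 0; 0; 0]);
  (1, [:: 1; 0; 0; 1; 0; 0; 0; 0]);
  (2, [:: 0; 3; 1; 4; 2; 3; 1; 2]);
  (0, [:: 1; 0; 2; 1; 2; 3; 4; 3]);
  (5, [:: 2; 6; 7; 3; 0; 4; 1; 5]);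
  (2, [:: 3; 6; 0; 7; 1; 4; 11; 2]);
  (10, [:: 6; 7; 8; 3; 4; 5; 2; 0]);
  (1, [:: 1; 1; 2; 2; 1; 0; 1; 1]);
  (1, [:: 1; 0; 1; 0; 1; 1; 0; 1]);
  (1, [:: 1; 1; 2; 1; 2; 0; 1; 1]);
  (1, [:: 1; 0; 1; 0; 1; 2; 1; 1]);
  (0, [:: 0; 1; 0; 0; 1; 1; 0; 1]);
  (0, [:: 0; 0; 1; 1; 0; 1; 0; 1]);
  (0, [:: 1; 0; 0; 0; 1; 0; 1; 1]);
  (1, [:: 2; 2; 1; 1; 0; 2; 0; 1]);
  (1, [:: 2; 1; 2; 0; 1; 2; 2; 1]);
  (1, [:: 2; 0; 1; 1; 1; 2; 0; 2]);
  (1, [:: 1; 0; 2; 1; 0; 2; 0; 1]);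
  (1, [:: 1; 2; 0; 2; 0; 1; 1; 0]);
  (1, [:: 0; 2; 1; 0; 2; 1; 2; 1]);
  (1, [:: 1; 2; 2; 2; 0; 1; 2; 1]);
  (1, [:: 1; 0; 0; 1; 1; 0; 0; 0]);
  (1, [:: 2; 0; 1; 1; 2; 0; 2; 1]);
  (1, [:: 1; 2; 0; 2; 0; 2; 1; 2]);
  (1, [:: 1; 2; 0; 2; 0; 1; 0; 2]);
  (1, [:: 0; 2; 1; 0; 2; 1; 2; 0]);
  (1, [:: 2; 0; 1; 1; 2; 0; 2; 0]);
  (1, [:: 0; 2; 1; 1; 0; 2; 2; 0]);
  (1, [:: 1; 0; 2; 0; 2; 2; 1; 2]);
  (2, [:: 3; 0; 2; 1; 2; 3; 1; 2]);
  (2, [:: 3; 1; 0; 2; 3; 4; 1; 2]);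
  (2, [:: 1; 3; 0; 2; 4; 3; 1; 2]);
  (3, [:: 5; 2; 0; 4; 2; 4; 6; 3]);
  (4, [:: 6; 1; 3; 5; 0; 7; 2; 4]);
  (4, [:: 1; 6; 3; 0; 7; 5; 2; 4]);
  (4, [:: 7; 2; 0; 5; 8; 3; 6; 4]);
  (4, [:: 1; 6; 3; 0; 8; 5; 2; 4]);
  (4, [:: 2; 7; 0; 5; 3; 8; 6; 4]);
  (2, [:: 1; 5; 0; 4; 3; 7; 6; 2]);
  (4, [:: 6; 0; 3; 2; 5; 7; 9; 4]);
  (5, [:: 7; 0; 2; 4; 6; 1; 3; 5]);
  (3, [:: 5; 0; 7; 2; 4; 6; 8; 3]);
  (6, [:: 8; 0; 5; 2; 7; 4; 9; 6]);
  (5, [:: 8; 4; 0; 7; 3; 6; 10; 5]);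
  (5, [:: 2; 6; 3; 0; 10; 7; 4; 5]);
  (5, [:: 1; 6; 2; 8; 3; 4; 0; 5]);
  (5, [:: 3; 8; 6; 4; 2; 0; 9; 5])].

Definition certificates : seq certificate := [::
Certificate (0, 3, 5) (1, 2, 5) [:: ((0, 1, 4), (0, [:: 0; 0; 0; 1; 0; 0; 0;
    0])); ((0, 3, 5), (1, [:: 1; 0; 1; 1; 1; 1; 1; 1]))] [:: (1%Z, (1, 0, 3),
    (4, 5, 7))];
Certificate (0, 1, 4) (0, 4, 5) [:: ((0, 1, 4), (1, [:: 1; 0; 1; 1; 0; 1; 1;
    1])); ((1, 2, 5), (1, [:: 1; 3; 0; 1; 2; 2; 1; 1]))] [:: ((-1)%Z, (0, 1,
    2), (4, 5, 6))];
Certificate (1, 3, 6) (2, 4, 6) [:: ((0, 1, 4), (1, [:: 1; 1; 1; 0; 1; 1; 1;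
    1])); ((1, 3, 6), (1, [:: 1; 2; 0; 0; 1; 1; 1; 0]))] [:: ((-1)%Z, (0, 1,
    3), (4, 6, 7))];
Certificate (0, 1, 3) (0, 2, 4) [:: ((0, 2, 4), (0, [:: 0; 0; 0; 1; 0; 0; 0;
    0])); ((0, 3, 5), (1, [:: 1; 1; 0; 1; 1; 1; 1; 1]))] [:: (1%Z, (2, 0, 3),
    (4, 5, 7))];
Certificate (0, 1, 3) (0, 3, 5) [:: ((0, 1, 3), (1, [:: 1; 0; 1; 0; 2; 1; 1;
    1])); ((0, 2, 4), (0, [:: 0; 1; 0; 0; 0; 0; 0; 0]))] [:: ((-1)%Z, (1, 0,
    2), (3, 4, 6))];
Certificate (0, 2, 4) (0, 4, 5) [:: ((0, 1, 3), (0, [:: 0; 0; 1; 0; 0; 0; 0;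
    0])); ((0, 2, 4), (1, [:: 1; 1; 0; 2; 0; 1; 1; 1]))] [:: (1%Z, (1, 0, 2),
    (3, 4, 6))];
Certificate (1, 2, 5) (0, 6, 7) [:: ((0, 2, 4), (1, [:: 1; 1; 1; 1; 1; 1; 1;
    0])); ((0, 6, 7), (1, [:: 1; 1; 0; 1; 1; 1; 1; 1]))] [:: (1%Z, (0, 2, 3),
    (4, 6, 7))];
Certificate (0, 2, 4) (3, 5, 7) [:: ((0, 5, 6), (1, [:: 1; 1; 1; 1; 1; 1; 1;
    0])); ((3, 5, 7), (1, [:: 0; 1; 1; 1; 1; 1; 1; 1]))] [:: ((-1)%Z, (1, 0,
    5), (3, 6, 7))];
Certificate (0, 1, 3) (4, 5, 7) [:: ((0, 5, 6), (1, [:: 1; 1; 1; 1; 1; 1; 1;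
    0])); ((4, 5, 7), (1, [:: 0; 1; 1; 1; 1; 1; 1; 1]))] [:: ((-1)%Z, (2, 0,
    5), (4, 6, 7))];
Certificate (0, 1, 3) (0, 2, 4) [:: ((0, 1, 3), (0, [:: 0; 0; 0; 0; 3; 0; 0;
    0])); ((1, 4, 6), (2, [:: 1; 0; 3; 2; 2; 1; 0; 2]))] [:: (3%Z, (0, 1, 4),
    (3, 6, 7))];
Certificate (0, 1, 3) (0, 2, 4) [:: ((0, 1, 3), (1, [:: 1; 1; 0; 1; 2; 1; 1;
    1])); ((0, 4, 5), (1, [:: 1; 0; 1; 1; 1; 1; 1; 1])); ((1, 2, 5), (2, [::
    2; 1; 4; 0; 4; 3; 2; 2]))] [:: ((-1)%Z, (0, 1, 2), (3, 5, 6)); (1%Z, (1,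
    0, 4), (3, 5, 7))];
Certificate (0, 1, 3) (1, 3, 5) [:: ((0, 1, 3), (1, [:: 0; 1; 1; 0; 1; 1; 1;
    1])); ((0, 2, 4), (0, [:: 1; 0; 0; 0; 1; 0; 0; 0]))] [:: ((-1)%Z, (1, 0,
    2), (3, 4, 6))];
Certificate (0, 2, 4) (1, 6, 7) [:: ((0, 1, 3), (0, [:: 0; 0; 1; 0; 0; 0; 0;
    0])); ((0, 2, 4), (1, [:: 1; 0; 1; 1; 1; 1; 1; 1]))] [:: (1%Z, (1, 0, 2),
    (3, 4, 5))];
Certificate (0, 1, 3) (2, 6, 7) [:: ((0, 1, 3), (1, [:: 1; 1; 0; 1; 1; 1; 1;
    1])); ((0, 2, 4), (0, [:: 0; 1; 0; 0; 0; 0; 0; 0]))] [:: ((-1)%Z, (1, 0,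
    2), (3, 4, 5))];
Certificate (0, 1, 3) (2, 4, 5) [:: ((0, 1, 3), (1, [:: 1; 1; 0; 1; 0; 1; 2;
    1])); ((1, 4, 6), (0, [:: 2; 0; 0; 0; 0; 0; 0; 0]))] [:: ((-2)%Z, (1, 0,
    2), (3, 4, 6))];
Certificate (0, 1, 3) (0, 3, 4) [:: ((0, 1, 3), (1, [:: 1; 0; 1; 0; 1; 1; 1;
    1])); ((1, 2, 5), (0, [:: 0; 1; 0; 0; 0; 1; 0; 0]))] [:: ((-1)%Z, (0, 1,
    2), (3, 5, 6))];
Certificate (0, 1, 3) (0, 3, 4) [:: ((0, 3, 4), (2, [:: 2; 0; 2; 2; 2; 2; 2;
    2])); ((1, 3, 5), (1, [:: 1; 2; 1; 2; 0; 3; 1; 1]))] [:: ((-2)%Z, (0, 3,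
    1), (4, 5, 6))];
Certificate (0, 1, 3) (1, 3, 5) [:: ((0, 3, 4), (1, [:: 2; 1; 1; 2; 3; 0; 1;
    1])); ((1, 3, 5), (2, [:: 0; 2; 2; 2; 2; 2; 2; 2]))] [:: (2%Z, (0, 3, 1),
    (4, 5, 6))];
Certificate (0, 1, 3) (0, 3, 4) [:: ((0, 1, 3), (1, [:: 0; 1; 1; 0; 1; 0; 1;
    1])); ((0, 5, 6), (0, [:: 0; 2; 2; 0; 0; 2; 2; 2]))] [:: ((-2)%Z, (1, 0,
    5), (3, 6, 7))];
Certificate (0, 3, 4) (0, 6, 7) [:: ((0, 3, 4), (5, [:: 3; 8; 5; 6; 4; 2; 0;
    5])); ((1, 3, 5), (3, [:: 0; 4; 3; 1; 5; 2; 6; 3]))] [:: (7%Z, (0, 3, 1),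
    (4, 5, 6))];
Certificate (0, 1, 3) (0, 3, 4) [:: ((0, 1, 3), (0, [:: 0; 0; 0; 0; 4; 0; 0;
    0])); ((0, 4, 5), (2, [:: 1; 0; 4; 3; 2; 1; 3; 2]))] [:: (4%Z, (1, 0, 4),
    (3, 5, 6))];
Certificate (0, 1, 3) (2, 4, 6) [:: ((0, 1, 3), (1, [:: 1; 0; 1; 0; 0; 1; 1;
    1])); ((0, 4, 5), (0, [:: 0; 1; 0; 0; 0; 0; 0; 0]))] [:: ((-1)%Z, (0, 1,
    2), (3, 4, 5))];
Certificate (0, 1, 3) (0, 3, 4) [:: ((0, 1, 3), (2, [:: 1; 1; 0; 0; 4; 3; 2;
    2])); ((1, 2, 4), (2, [:: 4; 4; 1; 1; 3; 0; 2; 2]))] [:: ((-5)%Z, (0, 1,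
    2), (3, 4, 5))];
Certificate (0, 1, 3) (2, 4, 6) [:: ((0, 1, 3), (4, [:: 2; 6; 0; 4; 2; 8; 6;
    4])); ((0, 4, 5), (4, [:: 5; 7; 6; 0; 1; 2; 3; 4]))] [:: ((-8)%Z, (0, 1,
    2), (3, 4, 5))];
Certificate (0, 2, 3) (0, 6, 7) [:: ((0, 2, 3), (3, [:: 1; 6; 4; 2; 0; 5; 3;
    3])); ((1, 2, 5), (2, [:: 2; 1; 1; 3; 3; 0; 2; 2]))] [:: (2%Z, (0, 2, 1),
    (3, 5, 6))];
Certificate (0, 3, 4) (0, 6, 7) [:: ((0, 3, 4), (1, [:: 1; 1; 1; 1; 1; 1; 0;
    1])); ((0, 5, 6), (2, [:: 3; 0; 1; 2; 4; 2; 3; 4]))] [:: (1%Z, (0, 3, 2),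
    (4, 5, 6))];
Certificate (0, 1, 2) (0, 2, 3) [:: ((0, 2, 3), (2, [:: 0; 0; 3; 1; 1; 4; 2;
    2])); ((0, 4, 5), (2, [:: 3; 3; 4; 0; 0; 1; 2; 2]))] [:: ((-5)%Z, (0, 2,
    1), (3, 4, 5))];
Certificate (0, 1, 2) (1, 2, 4) [:: ((0, 1, 2), (2, [:: 1; 2; 1; 0; 4; 3; 2;
    2])); ((1, 3, 5), (1, [:: 3; 1; 0; 2; 0; 2; 1; 1]))] [:: ((-3)%Z, (0, 1,
    3), (2, 5, 6))];
Certificate (0, 1, 2) (0, 2, 3) [:: ((0, 1, 2), (2, [:: 2; 1; 1; 4; 0; 3; 2;
    2])); ((0, 4, 5), (1, [:: 1; 3; 0; 0; 2; 2; 1; 1]))] [:: ((-3)%Z, (1, 0,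
    4), (2, 5, 6))];
Certificate (1, 2, 4) (1, 6, 7) [:: ((0, 2, 3), (2, [:: 1; 2; 1; 0; 3; 3; 2;
    2])); ((1, 2, 4), (3, [:: 6; 1; 4; 5; 2; 0; 3; 3]))] [:: ((-2)%Z, (0, 2,
    1), (3, 4, 6))];
Certificate (0, 1, 2) (0, 4, 5) [:: ((0, 4, 5), (5, [:: 4; 3; 6; 5; 4; 3; 2;
    0])); ((3, 4, 7), (2, [:: 0; 2; 0; 2; 0; 2; 0; 0]))] [:: ((-4)%Z, (2, 0,
    4), (3, 5, 7))];
Certificate (0, 1, 2) (0, 2, 3) [:: ((0, 2, 3), (4, [:: 2; 0; 6; 4; 2; 8; 6;
    4])); ((0, 4, 5), (4, [:: 5; 6; 7; 0; 1; 2; 3; 4]))] [:: ((-8)%Z, (0, 2,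
    1), (3, 4, 5))];
Certificate (0, 2, 3) (1, 5, 7) [:: ((0, 2, 3), (8, [:: 8; 8; 8; 8; 8; 0; 8;
    8])); ((0, 4, 5), (3, [:: 2; 1; 0; 7; 6; 5; 4; 3]))] [:: (8%Z, (0, 2, 1),
    (3, 4, 5))];
Certificate (0, 2, 3) (0, 5, 6) [:: ((0, 2, 3), (4, [:: 2; 8; 6; 4; 2; 0; 6;
    4])); ((1, 2, 4), (3, [:: 0; 5; 2; 7; 4; 9; 6; 3]))] [:: (8%Z, (0, 2, 1),
    (3, 4, 5))];
Certificate (0, 4, 5) (1, 6, 7) [:: ((0, 2, 3), (3, [:: 6; 0; 3; 6; 9; 3; 6;
    3])); ((0, 4, 5), (6, [:: 4; 2; 0; 7; 5; 3; 1; 6])); ((1, 2, 4), (3, [::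
    7; 2; 6; 1; 5; 0; 4; 3]))] [:: (9%Z, (2, 0, 4), (3, 5, 7))];
Certificate (0, 1, 2) (0, 2, 3) [:: ((0, 1, 2), (9, [:: 0; 9; 0; 9; 0; 0; 9;
    0])); ((0, 5, 6), (8, [:: 12; 16; 2; 6; 10; 0; 4; 8]))] [:: ((-18)%Z, (0,
    1, 4), (2, 5, 6))]].

(** Each entry is a diagram with the relabelling that leads to it. As [lex_ok] compares with
    transpositions of adjacent nodes only, one diagram may pass in several orders. *)
Definition survivors : seq (seq arrow * seq nat) := [::
  (D9, [:: 0; 1; 2; 3; 4; 5; 6; 7]);
  (E1, [:: 0; 1; 2; 3; 4; 5; 6; 7]);
  (D8, [:: 0; 1; 2; 3; 4; 5; 6; 7]);
  (E2, [:: 0; 1; 2; 3; 4; 5; 6; 7]);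
  (D1, [:: 0; 1; 2; 3; 5; 4; 6; 7]);
  (D1, [:: 1; 0; 2; 4; 3; 5; 6; 7]);
  (D3, [:: 0; 1; 2; 3; 5; 4; 7; 6]);
  (D2, [:: 0; 1; 2; 3; 4; 5; 6; 7]);
  (E3, [:: 0; 1; 2; 3; 4; 5; 6; 7]);
  (D6, [:: 0; 1; 2; 3; 4; 5; 6; 7]);
  (D6, [:: 2; 3; 0; 1; 4; 5; 6; 7]);
  (E4, [:: 0; 1; 2; 3; 4; 5; 6; 7]);
  (E4, [:: 0; 1; 2; 3; 4; 5; 7; 6]);
  (E5, [:: 0; 1; 2; 3; 4; 5; 6; 7]);
  (E6, [:: 0; 1; 2; 3; 4; 5; 6; 7]);
  (E6, [:: 0; 2; 1; 4; 3; 5; 6; 7]);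
  (D4, [:: 0; 1; 2; 3; 5; 4; 6; 7]);
  (E7, [:: 0; 1; 2; 3; 4; 5; 6; 7])].

Definition leaf_ok (D : seq arrow) : bool :=
  nilp D ||| some (isolates D) gradings ||| some (refutes D) certificates
    ||| some (survives D) survivors.

Lemma search_ok : all leaf_ok (search 8).
Proof. by vm_compute. Qed.

Lemma survivors_wf : all (fun e : seq arrow * seq nat => uniq e.1 &&
  all (fun a : arrow => (a.1.1 < a.1.2 < 8) && (a.2 < 8)) e.1) survivors.
Proof. by vm_compute. Qed.

Import Order.TTheory GRing.Theory Num.Theory.
Local Open Scope ring_scope.

(** * The Ricci tensor in a nice basis *)

Definition weight (R : realType) n (g : 'I_n -> R) (c : sconst R n) i j k : R :=
  c i j k ^+ 2 * g k / (g i * g j).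

(** The sum runs over ordered pairs, so every arrow at v is counted twice: this is twice the
    incoming minus twice the outgoing weight. *)
Definition net_weight (R : realType) n (g : 'I_n -> R) (c : sconst R n) v : R :=
  \sum_i \sum_m (weight g c m i v - weight g c i v m - weight g c v m i).

Definition balanced (R : realType) n (g : 'I_n -> R) (c : sconst R n) : Prop :=
  forall v, net_weight g c v = 0.

Section Ricci.
Variables (R : realType) (n : nat) (c : sconst R n).

(** The summand of the Ricci tensor takes its simple form only after symmetrization in the two
    summation indices. *)
Lemma big_sym2 (F : 'I_n -> 'I_n -> R) :
  \sum_i \sum_m F i m = 2^-1 * \sum_i \sum_m (F i m + F m i).
Proof.
under [in RHS]eq_bigr do rewrite big_split /=.
rewrite big_split /= [X in _ + X]exchange_big /=; lra.
Qed.

Definition height_function (h : 'I_n -> nat) :=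
  forall i j k, c i j k != 0 -> (h i < h k)%N.

Hypotheses (clie : is_lie c) (cnice : nice c).

Lemma lie_anti i j k : c i j k = - c j i k. Proof. by case: clie => _ []. Qed.

Lemma nice_out i j k k' : c i j k != 0 -> c i j k' != 0 -> k = k'.
Proof.
have [h hP] := (proj1 cnice) i j.
move=> /[swap]; have [->|/hP ->] := eqVneq k' h; last by rewrite eqxx.
by move=> _; have [->|/hP ->] := eqVneq k h; rewrite ?eqxx.
Qed.

Lemma nice_in i j j' k : c i j k != 0 -> c i j' k != 0 -> j = j'.
Proof.
have [h hP] := (proj2 cnice) i k.
move=> /[swap]; have [->|/hP ->] := eqVneq j' h; last by rewrite eqxx.
by move=> _; have [->|/hP ->] := eqVneq j h; rewrite ?eqxx.
Qed.

(* In a nice basis a path of length t in the graph i -> k (when [e_j, e_i] has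
   an e_k component) yields a nonzero product of t adjoint maps. *)
Fixpoint reach t (v : 'I_n) : bool :=
  if t is t'.+1 then [exists i, exists j, (c i j v != 0) && reach t' i] else true.

(** A column of the product has its only nonzero entry in row v. By niceness one more factor moves
    this entry to a single new row, so nothing can cancel along the path. *)
Lemma reach_foldr t v : reach t v ->
  exists2 s : t.-tuple 'I_n, True & exists i0,
    let M := foldr (fun i M => ad c i *m M) 1%:M s in
    M v i0 != 0 /\ forall v', v' != v -> M v' i0 = 0.
Proof.
elim: t v => [v _|t IH v /= /existsP[i /existsP[j /andP[nz /IH]]]].
  exists [tuple] => //; exists v => /=; split=> [|v' vv'].
    by rewrite mxE eqxx oner_eq0.
  by rewrite mxE (negbTE vv').
case=> s _ [i0 /= [Mi M0]]; exists [tuple of j :: s] => //; exists i0 => /=.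
have E v' : (ad c j *m foldr (fun i M => ad c i *m M) 1%:M s) v' i0
    = c j i v' * foldr (fun i M => ad c i *m M) 1%:M s i i0.
  rewrite mxE (bigD1 i) //= big1 ?addr0 ?mxE // => m mi.
  by rewrite M0 ?mulr0.
rewrite lie_anti oppr_eq0 in nz.
split=> [|v' vv']; rewrite E; first by rewrite mulf_neq0.
have [->|nz'] := eqVneq (c j i v') 0; first by rewrite mul0r.
by rewrite (nice_out nz' nz) eqxx in vv'.
Qed.

(** The height of a node is the length of the longest path ending there. Paths of length [N] or more
    do not exist, since they would give nonzero products of adjoint maps. *)
Lemma nilpotent_height : nilpotent c -> exists h, height_function h.
Proof.
case=> N cN.
have rN t v : (N <= t)%N -> ~~ reach t v.
  elim: t v => [|t IH] v; last rewrite leq_eqVlt => /orP[/eqP Nt|Nt].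
  - rewrite leqn0 => /eqP N0; apply/negP => /reach_foldr[s _ [i0 [/= + _]]].
    by rewrite -N0 in s *; rewrite cN mxE eqxx.
  - rewrite -Nt; apply/negP => /reach_foldr[s _ [i0 [/= + _]]].
    by rewrite cN mxE eqxx.
  - by apply/existsP => -[i /existsP[j /andP[_]]]; apply/negP/IH.
pose h v := \max_(t < N.+1 | reach t v) t; exists h => i j k nz.
have [t0 rt0 ht0] : exists2 t : 'I_N.+1, reach t i & h i = t.
  rewrite /h; have [|t rt ->] := @eq_bigmax_cond _ [pred t : 'I_N.+1 | reach t i] val.
    by apply/card_gt0P; exists ord0.
  by exists t.
have rk : reach t0.+1 k.
  by apply/existsP; exists i; apply/existsP; exists j; rewrite nz.
have tN : (t0.+1 < N.+1)%N.
  by rewrite ltnS ltnNge -ltnS ltnS; apply: contraL rk => /leqW; apply: rN.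
by rewrite ht0; apply: (@leq_bigmax_cond _ (fun t : 'I_N.+1 => reach t k) val (Ordinal tN)).
Qed.

Variables (h : 'I_n -> nat) (g : 'I_n -> R).
Hypotheses (hP : height_function h) (gnz : forall i, g i != 0).

Lemma acyclic2 i j k m : c i j k * c k m i = 0.
Proof.
apply/eqP; rewrite mulf_eq0 -[_ || _]negbK negb_or; apply/andP => -[/hP ik /hP].
by rewrite ltnNge ltnW.
Qed.

(** The traces of the connection vanish because the diagram has no cycles, and so do the mixed
    products c_ijm c_lmi for the diagonal entry. Each remaining product pairs two constants that
    differ only in having j or l at the same place; niceness makes it zero unless j = l. *)
Lemma ricciE j l : ricci g c j l = 4^-1 * \sum_i \sum_m
  (if j == l then
     g j * (weight g c m i j - weight g c i j m - weight g c j m i) else 0).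
Proof.
have tr i m : Gamma g c i m i = 0.
  have cii : c i m i = 0.
    by apply/eqP; rewrite -[_ == _]orbb -mulf_eq0 acyclic2.
  by rewrite /Gamma (lie_anti m) cii (proj1 clie) !(mulr0, oppr0, subr0, addr0, mul0r).
rewrite /ricci big_sym2 (_ : 4^-1 = 2^-1 * 2^-1); last by field.
rewrite -mulrA; congr (_ * _).
rewrite mulr_sumr; apply: eq_bigr => i _; rewrite mulr_sumr; apply: eq_bigr => m _.
rewrite !tr !mulr0 !sub0r /Gamma.
rewrite (lie_anti j i m) (lie_anti i m j) (lie_anti m j i).
rewrite (lie_anti l i m) (lie_anti i m l) (lie_anti m l i).
have z1 : c i j m * c l m i = 0 by rewrite (lie_anti l) mulrN acyclic2 oppr0.
have z2 : c i l m * c j m i = 0 by rewrite (lie_anti j) mulrN acyclic2 oppr0.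
have gi := gnz i; have gm := gnz m.
set p := c i j m in z1 z2 *; set q := c j m i in z1 z2 *; set r := c m i j.
set p' := c i l m in z1 z2 *; set q' := c l m i in z1 z2 *; set r' := c m i l.
have -> : - ((g m * p' - g i * q' + g l * r') / (2 * g m) *
     ((g i * q - g j * r + g m * p) / (2 * g i))) -
  p * ((g i * - q' - g m * - p' + g l * - r') / (2 * g i)) +
  (- ((g i * - q' - g m * - p' + g l * - r') / (2 * g i) *
      ((g m * - p - g j * - r + g i * - q) / (2 * g m))) -
   - q * ((g m * p' - g i * q' + g l * r') / (2 * g m))) =
  (g l * g j * (r * r') - g m ^+ 2 * (p * p') - g i ^+ 2 * (q * q')
   + g i * g m * (p * q' + p' * q)) / (2 * (g i * g m)).
  by field; rewrite gi gm.
rewrite z1 z2 addr0 mulr0 addr0.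
case: eqVneq => [jl|jl].
  rewrite /weight -jl -/r -/p -/q; have gj := gnz j.
  have -> : p' = p by rewrite /p' -jl.
  have -> : q' = q by rewrite /q' -jl.
  have -> : r' = r by rewrite /r' -jl.
  by field; rewrite gi gm gj.
have zz (x y : R) : (x != 0 -> y != 0 -> False) -> x * y = 0.
  move=> H; apply/eqP; rewrite mulf_eq0 -[_ || _]negbK negb_or.
  by apply/andP => -[/H]; apply.
have -> : r * r' = 0 by apply: zz => /nice_out/[apply]/eqP; rewrite (negbTE jl).
have -> : p * p' = 0 by apply: zz => /nice_in/[apply]/eqP; rewrite (negbTE jl).
have -> : q * q' = 0.
  rewrite /q /q' (lie_anti j) (lie_anti l) mulrNN.
  by apply: zz => /nice_in/[apply]/eqP; rewrite (negbTE jl).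
by rewrite !mulr0 !subr0 mul0r.
Qed.

Lemma ricci_flat_balanced : (forall j l, ricci g c j l = 0) <-> balanced g c.
Proof.
split=> [H v|H j l].
  move/eqP: (H v v); rewrite ricciE eqxx.
  under eq_bigr do rewrite -mulr_sumr.
  by rewrite -mulr_sumr !mulf_eq0 (negbTE (gnz v)) invr_eq0 pnatr_eq0 /= => /eqP.
rewrite ricciE; case: eqVneq => [->|_]; last by rewrite big1 ?mulr0 // => i _; rewrite big1.
by under eq_bigr do rewrite -mulr_sumr; rewrite -mulr_sumr [X in _ * (_ * X)]H !mulr0.
Qed.

End Ricci.

(** * Weights on a diagram *)

Definition has_diagram (R : realType) (c : sconst R 8) (D : seq arrow) : Prop :=
  [/\ uniq D,
      all (fun a : arrow => (a.1.1 < a.1.2 < 8)%N && (a.2 < 8)%N) D &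
      forall i j k : 'I_8, (c i j k != 0) = (norm i j k \in D)].

Definition arrow_weight (R : realType) (g : 'I_8 -> R) (c : sconst R 8) (a : arrow) : R :=
  weight g c (inord a.1.1) (inord a.1.2) (inord a.2).

Lemma normC i j k : norm i j k = norm j i k.
Proof. by rewrite /norm; case: ltngtP => // ->. Qed.

Section Diagram.
Variables (R : realType) (c : sconst R 8) (g : 'I_8 -> R) (D : seq arrow).
Hypotheses (clie : is_lie c) (cnice : nice c) (gnz : forall i, g i != 0).
Hypothesis cD : has_diagram c D.
Local Notation X := (arrow_weight g c).

Lemma weight_sym i j k : weight g c i j k = weight g c j i k.
Proof. by rewrite /weight (lie_anti clie) sqrrN [g i * _]mulrC. Qed.

Lemma arrow_weight_norm (i j k : 'I_8) : X (norm i j k) = weight g c i j k.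
Proof.
by rewrite /norm /arrow_weight; case: ifP; rewrite !inord_val // weight_sym.
Qed.

Lemma diagram_bound i j k : (i, j, k) \in D -> [/\ (i < j)%N, (i < 8)%N, (j < 8)%N & (k <
  8)%N].
Proof.
case: cD => _ /allP H _ /H /= /andP[/andP[ij j8] k8]; split=> //.
exact: ltn_trans j8.
Qed.

Lemma diagram_nz i j k : (i, j, k) \in D -> c (inord i) (inord j) (inord k) != 0.
Proof.
move=> ijk; have [ij i8 j8 k8] := diagram_bound ijk.
by case: cD => _ _ ->; rewrite !inordK // /norm ij.
Qed.

Lemma arrow_weight_nz a : a \in D -> X a != 0.
Proof.
case: a => [[i j] k] /diagram_nz nz.
by rewrite /arrow_weight /weight /= !mulf_neq0 ?invr_neq0 ?mulf_neq0 ?expf_neq0.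
Qed.

Lemma sum_diagram (F : 'I_8 -> 'I_8 -> 'I_8 -> R) :
  (forall i j k, F i j k = F j i k) -> (forall i j k, c i j k = 0 -> F i j k = 0) ->
  \sum_i \sum_j \sum_k F i j k =
  2 * \sum_(a <- D) F (inord a.1.1) (inord a.1.2) (inord a.2).
Proof.
move=> Fsym F0; pose G i j := \sum_k F i j k.
have Gsym i j : G i j = G j i by apply: eq_bigr => k _.
have Gd i : G i i = 0 by rewrite /G big1 // => k _; rewrite F0 // (proj1 clie).
have -> : \sum_i \sum_j \sum_k F i j k = 2 * \sum_(i : 'I_8) \sum_(j : 'I_8 | (i < j)%N)
  G i j.
  transitivity (\sum_(i : 'I_8) \sum_(j : 'I_8 | (i < j)%N) G i j
                + \sum_(i : 'I_8) \sum_(j : 'I_8 | (j < i)%N) G i j).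
    rewrite -big_split; apply: eq_bigr => i _ /=.
    rewrite -/(\sum_j G i j) (bigID (fun j : 'I_8 => (i < j)%N)) /=; congr (_ + _).
    rewrite (bigD1 i) ?ltnn //= [X in X + _]Gd add0r; apply: eq_bigl => j.
    by rewrite -leqNgt ltn_neqAle andbC.
  rewrite [X in _ + X](exchange_big_dep predT) //= mulrDl mul1r; congr (_ + _).
  by apply: eq_bigr => i _; apply: eq_bigr => j _; rewrite Gsym.
congr (2 * _); pose enc (a : arrow) : 'I_8 * 'I_8 * 'I_8 :=
  (inord a.1.1, inord a.1.2, inord a.2).
transitivity (\sum_(p <- map enc D) F p.1.1 p.1.2 p.2); last by rewrite big_map.
have [uD _ suppD] := cD.
have encK : {in D, cancel enc (fun p => (p.1.1 : nat, p.1.2 : nat, p.2 : nat))}.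
  by move=> [[i j] k] /diagram_bound[_ i8 j8 k8]; rewrite /= !inordK.
rewrite [RHS]big_uniq ?map_inj_in_uniq //=; last exact: can_in_inj encK.
rewrite pair_big_dep pair_big_dep /=.
rewrite (bigID (mem (map enc D))) /= [X in _ + X]big1 ?addr0 => [|[[i j] k] /= /andP[ij]].
  apply: eq_bigl => -[[i j] k] /=; case: (boolP (_ \in _)); rewrite ?andbT ?andbF //.
  case/mapP => -[[i' j'] k'] inD [-> -> _].
  by have [ij i8 j8 k8] := diagram_bound inD; rewrite !inordK.
move=> nD; apply: F0; apply/eqP/negPn/negP => nz; case/mapP: nD.
exists (i : nat, j : nat, k : nat); last by rewrite /enc /= !inord_val.
by move: nz; rewrite suppD /norm; move: ij; rewrite andbT => ->.
Qed.

(** Summation by parts: in the sum over nodes an arrow ij -> k collects w_k from its target and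
    -w_i, -w_j from its sources. The factor 2 comes from the two orders of the sources. *)
Lemma graded_sum (w : 'I_8 -> R) :
  \sum_v w v * net_weight g c v =
  2 * \sum_(a <- D) (w (inord a.2) - w (inord a.1.1) - w (inord a.1.2)) * X a.
Proof.
rewrite -(sum_diagram (F := fun i j k => (w k - w i - w j) * weight g c i j k)).
- under eq_bigr => v _.
    rewrite mulr_sumr; under eq_bigr => i _ do rewrite mulr_sumr.
    over.
  have E (F1 F2 F3 : 'I_8 -> 'I_8 -> 'I_8 -> R) :
     \sum_v \sum_i \sum_m (F1 v i m - F2 v i m - F3 v i m) =
     \sum_i \sum_m \sum_v F1 v i m - \sum_i \sum_v \sum_m F2 v i m
     - \sum_v \sum_m \sum_i F3 v i m.
    under eq_bigr => v _ do under eq_bigr => i _ do rewrite !sumrB.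
    under eq_bigr => v _ do rewrite !sumrB.
    rewrite !sumrB; congr (_ - _ - _).
    - rewrite exchange_big; apply: eq_bigr => i _; exact: exchange_big.
    - exact: exchange_big.
    - by apply: eq_bigr => v _; exact: exchange_big.
  under eq_bigr => v _ do under eq_bigr => i _ do under eq_bigr => m _ do
    rewrite mulrBr mulrBr.
  rewrite E -!sumrB; apply: eq_bigr => i _; rewrite -!sumrB; apply: eq_bigr => j _.
  rewrite -!sumrB; apply: eq_bigr => k _.
  rewrite (weight_sym j i); ring.
- by move=> i j k; rewrite weight_sym; ring.
- by move=> i j k c0; rewrite /weight c0; ring.
Qed.

Lemma balanced_graded : balanced g c -> forall w : 'I_8 -> R,
  \sum_(a <- D) (w (inord a.2) - w (inord a.1.1) - w (inord a.1.2)) * X a = 0.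
Proof.
move=> bal w; have := graded_sum w; rewrite big1 => [/esym/eqP|v _].
  by rewrite mulf_eq0 pnatr_eq0 => /eqP.
by rewrite bal mulr0.
Qed.

Lemma graded_balanced :
  (forall v : 'I_8, \sum_(a <- D) ((a.2 == v)%:R - (a.1.1 == v)%:R - (a.1.2 == v)%:R) * X
    a = 0)
  -> balanced g c.
Proof.
move=> H v; have := graded_sum (fun u => (u == v)%:R).
rewrite (bigD1 v) //= eqxx mul1r big1 ?addr0 => [|i /negbTE->]; last by rewrite mul0r.
move=> ->; rewrite -[RHS](mulr0 2); congr (2 * _).
rewrite -[RHS](H v); apply: eq_big_seq => -[[i j] k] /diagram_bound[_ i8 j8 k8] /=.
by rewrite -!val_eqE /= !inordK.
Qed.

(** Every bracket of basis vectors has at most one component, so each of the three sums in the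
    Jacobi identity has at most one term; the last hypothesis removes the third. *)
Lemma jacobi_two_terms (i j k m m' l : 'I_8) :
  norm i j m \in D -> norm j k m' \in D ->
  (forall n : 'I_8, ~ (norm k i n \in D /\ norm j n l \in D)) ->
  c i j m * c k m l = - (c j k m' * c i m' l).
Proof.
have [_ _ suppD] := cD; rewrite -!suppD => ijm jkm' none.
have [_ [_ /(_ i j k l)]] := clie; rewrite !big_split /=.
rewrite (bigD1 m') //= [X in _ + X + _ + _]big1 => [|n nm']; last first.
  have [->|nz] := eqVneq (c j k n) 0; first by rewrite mul0r.
  by rewrite (nice_out cnice nz jkm') eqxx in nm'.
rewrite [X in _ + X + _]big1 => [|n _]; last first.
  apply/eqP/negPn/negP; rewrite mulf_eq0 negb_or => /andP[n1 n2].
  by apply: (none n); rewrite -!suppD.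
rewrite (bigD1 m) //= [X in _ + (_ + X)]big1 => [|n nm]; last first.
  have [->|nz] := eqVneq (c i j n) 0; first by rewrite mul0r.
  by rewrite (nice_out cnice nz ijm) eqxx in nm.
by rewrite !addr0 => /eqP; rewrite addrC addr_eq0 => /eqP.
Qed.

(** Square the two-term identity. The metric coefficient of the intermediate node cancels on each
    side, and both sides carry the same factor g_l / (g_i g_j g_k). *)
Lemma jacobi_weight x y : jacobi_pair D x y ->
  X (norm x.1.1 x.1.2 y.1.1) * X (norm x.2 y.1.1 y.2) =
  X (norm x.1.2 x.2 y.1.2) * X (norm x.1.1 y.1.2 y.2).
Proof.
case: x y => [[i j] k] [[m m'] l] /=.
case/and5P => a1 a2 a3 a4 /allP a5.
have bd u v w : norm u v w \in D -> [/\ (u < 8)%N, (v < 8)%N & (w < 8)%N].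
  by rewrite /norm; case: ifP => _ /diagram_bound[].
have [i8 j8 m8] := bd _ _ _ a1; have [k8 _ l8] := bd _ _ _ a2;
  have [_ _ m'8] := bd _ _ _ a3.
rewrite (arrow_weight_norm (Ordinal i8) (Ordinal j8) (Ordinal m8)).
rewrite (arrow_weight_norm (Ordinal k8) (Ordinal m8) (Ordinal l8)).
rewrite (arrow_weight_norm (Ordinal j8) (Ordinal k8) (Ordinal m'8)).
rewrite (arrow_weight_norm (Ordinal i8) (Ordinal m'8) (Ordinal l8)).
have := @jacobi_two_terms (Ordinal i8) (Ordinal j8) (Ordinal k8) (Ordinal m8)
  (Ordinal m'8) (Ordinal l8) a1 a3.
have none (n : 'I_8) : ~ (norm k i n \in D /\ norm j n l \in D).
  case=> /a5; have -> : joins k i (norm k i n).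
    by rewrite /norm; case: ifP => _; rewrite /joins !eqnE !eqxx //=; case: ifP.
  by have -> : (norm k i n).2 = n by [rewrite /norm; case: ifP]; move=> /= /negbTE ->.
move=> /(_ none) E; rewrite /weight.
have E2 := congr1 (fun z => z ^+ 2) E; rewrite /= sqrrN !exprMn in E2.
have g1 := gnz (Ordinal i8); have g2 := gnz (Ordinal j8); have g3 := gnz (Ordinal k8).
have g4 := gnz (Ordinal m8); have g5 := gnz (Ordinal m'8).
transitivity (c (Ordinal i8) (Ordinal j8) (Ordinal m8) ^+ 2 * c (Ordinal k8) (Ordinal m8)
  (Ordinal l8) ^+ 2
   * g (Ordinal l8) / (g (Ordinal i8) * g (Ordinal j8) * g (Ordinal k8))).
  by field; rewrite g1 g2 g3 g4.
by rewrite E2; field; rewrite g1 g2 g3 g5.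
Qed.

Section Balanced.
Hypothesis bal : balanced g c.

Lemma defect_sum (w : nat * seq nat) : \sum_(a <- D) (defect w a)%:~R * X a = 0.
Proof.
rewrite -[RHS](balanced_graded bal (fun u => (nth 0 w.2 u)%:R - w.1%:R)).
apply: eq_big_seq => -[[i j] k] /diagram_bound[_ i8 j8 k8] /=.
rewrite !inordK // rmorphB /= -!pmulrn !natrD; ring.
Qed.

Lemma neutral_defect w a : neutral w a = (defect w a == 0).
Proof. by case: a => [[i j] k]; rewrite /= subr_eq0 eqnE eqz_nat. Qed.

Lemma isolates_false w : isolates D w -> False.
Proof.
rewrite /isolates eqnE -size_filter => /eqP s1.
have := defect_sum w; rewrite (bigID (neutral w)) /= big1 ?add0r => [|a]; last first.
  by rewrite neutral_defect => /eqP ->; rewrite mul0r.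
rewrite -big_filter; set s := filter _ _ in s1 *.
have sP a : a \in s -> (a \in D) && ~~ neutral w a by rewrite mem_filter andbC.
case: s s1 sP => [|a [|//]] //= _ /(_ a (mem_head _ _)) /andP[aD na].
rewrite big_seq1 => /eqP; rewrite mulf_eq0 intr_eq0 -neutral_defect (negbTE na) /=.
by rewrite (negbTE (arrow_weight_nz aD)).
Qed.

Definition form_value (L : seq (int * arrow * arrow)) : R :=
  \sum_(t <- L) t.1.1%:~R * (X t.1.2 * X t.2).

Lemma same_pair_weight t t' : same_pair t t' -> X t'.1.2 * X t'.2 = X t.1.2 * X t.2.
Proof.
rewrite /same_pair !arrow_eqE.
case: eqVneq => [->|_] /=.
  case: eqVneq => [->|_] //=; case: eqVneq => [->|_] //= /eqP ->; ring.
by case: eqVneq => [->|_] //= /eqP ->; ring.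
Qed.

Lemma coef_sum_value t L : form_value (filter (same_pair t) L) =
  (coef_sum (filter (same_pair t) L))%:~R * (X t.1.2 * X t.2).
Proof.
rewrite /form_value; elim: L => [|t' L IH] /=; first by rewrite big_nil mul0r.
case: ifP => // /same_pair_weight E; rewrite big_cons IH E /= rmorphD /=; ring.
Qed.

Lemma form_value_split (P : pred (int * arrow * arrow)) L :
  form_value L = form_value (filter P L) + form_value (filter (fun t => ~~ P t) L).
Proof. by rewrite /form_value (bigID P) /= !big_filter. Qed.

Lemma vanishes_value f L : vanishes f L -> form_value L = 0.
Proof.
elim: f L => //= f IH [_|t L]; first by rewrite /form_value big_nil.
case/andP => /eqP c0 /IH v0.
by rewrite (form_value_split (same_pair t)) v0 coef_sum_value c0 mul0r addr0.
Qed.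

Lemma form_value_flatten (I : Type) (F : I -> seq (int * arrow * arrow)) s :
  form_value (flatten [seq F i | i <- s]) = \sum_(i <- s) form_value (F i).
Proof.
rewrite /form_value; elim: s => [|i s IH] /=; first by rewrite !big_nil.
by rewrite big_cat IH big_cons.
Qed.

(** Each linear part is a weight times a graded sum, and each quadratic part is a difference of
    equal products. *)
Lemma terms_value C : all (fun t => jacobi_pair D t.1.2 t.2) (jacobi_part C) ->
  form_value (terms D C) = 0.
Proof.
move=> /allP jP; rewrite /terms {1}/form_value big_cat /=.
rewrite -[X in X + _]/(form_value _) -[X in _ + X]/(form_value _) !form_value_flatten.
rewrite big1 ?add0r => [|p _]; last first.
  rewrite /form_value big_map /=.
  rewrite (eq_bigr (fun a => X p.1 * ((defect p.2 a)%:~R * X a))) => [|a _]; last by ring.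
  by rewrite -mulr_sumr defect_sum mulr0.
apply: big1_seq => -[[q x] y] /= /jP /= /jacobi_weight.
case: x y => [[i j] k] [[m m'] l] /= E.
by rewrite /form_value !big_cons big_nil /= E rmorphN /=; ring.
Qed.

Lemma refutes_false C : refutes D C -> False.
Proof.
case/and5P => t1 t2 jP nz v0; set t0 := (0, target1 C, target2 C) in nz v0.
have := terms_value jP; rewrite (form_value_split (same_pair t0)) coef_sum_value.
rewrite (vanishes_value v0) addr0 => /eqP; rewrite mulf_eq0 intr_eq0 (negbTE nz) /=.
by rewrite -[_ == 0]/(X (target1 C) * X (target2 C) == 0)
  (negbTE (mulf_neq0 (arrow_weight_nz t1) (arrow_weight_nz t2))).
Qed.

End Balanced.
End Diagram.

(** * A minimal topological order of the basis *)

Lemma lexle_refl : reflexive lexle.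
Proof. by elim=> //= x s IH; rewrite eqnE eqxx. Qed.

Lemma lexle_trans : transitive lexle.
Proof.
move=> t s; elim: s t => [|x s IH] [|y t] [|z u] //=; rewrite !eqnE.
case: ltngtP => // [xy _|->].
  by case: ltngtP => // [yz _|<- _];
    rewrite ?ltn_eqF // ?(ltn_trans xy) //= ltnW // (ltn_trans xy).
by case: ltngtP => // _; apply: IH.
Qed.

Lemma lexle_total : total lexle.
Proof.
by elim=> [|x s IH] [|y t] //=; rewrite !eqnE (eq_sym y); case: ltngtP => //= _; apply: IH.
Qed.

Definition permute (R : realType) n (s : 'S_n) (c : sconst R n) : sconst R n :=
  fun i j k => c (s i) (s j) (s k).

Section Permute.
Variables (R : realType) (n : nat) (s : 'S_n) (c : sconst R n).

Lemma permute_lie : is_lie c -> is_lie (permute s c).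
Proof.
case=> [c0 [anti jac]]; split=> [i k|]; first exact: c0.
split=> [i j k|i j k l]; first exact: anti.
rewrite -[RHS](jac (s i) (s j) (s k) (s l)) [RHS](reindex_inj (@perm_inj _ s)).
by [].
Qed.

Lemma permute_nice : nice c -> nice (permute s c).
Proof.
case=> n1 n2; split=> i j.
  have [h hP] := n1 (s i) (s j); exists ((s^-1)%g h) => k kh; apply: hP.
  by apply: contraNneq kh => <-; rewrite permK.
have [h hP] := n2 (s i) (s j); exists ((s^-1)%g h) => k kh; apply: hP.
by apply: contraNneq kh => <-; rewrite permK.
Qed.

Lemma permute_balanced (g : 'I_n -> R) :
  balanced g c -> balanced (g \o s) (permute s c).
Proof.
move=> bal v; rewrite -[RHS](bal (s v)) /net_weight.
rewrite [RHS](reindex_inj (@perm_inj _ s)); apply: eq_bigr => i _ /=.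
by rewrite [RHS](reindex_inj (@perm_inj _ s)).
Qed.

End Permute.

(** * From structure constants to diagrams *)

Section Support.
Variables (R : realType) (c : sconst R 8).

(** The bounds are explicit because [inord] sends numbers out of range to 0. *)
Definition supp (i j k : nat) : bool :=
  [&& (i < 8)%N, (j < 8)%N, (k < 8)%N & c (inord i) (inord j) (inord k) != 0].

Lemma suppE (i j k : 'I_8) : supp i j k = (c i j k != 0).
Proof. by rewrite /supp !ltn_ord !inord_val. Qed.

Definition topological : bool :=
  [forall i : 'I_8, forall j : 'I_8, forall k : 'I_8,
     (c i j k != 0) ==> (i < k)%N && (j < k)%N].

Hypotheses (clie : is_lie c) (cnice : nice c) (ctop : topological).

Lemma supp_bound i j k : supp i j k -> (k < 8)%N.
Proof. by case/and4P. Qed.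

Lemma supp_sym i j k : supp i j k = supp j i k.
Proof. by rewrite /supp (lie_anti clie) oppr_eq0 andbCA. Qed.

Lemma supp_tri i j k : supp i j k -> [&& i != j, (i < k)%N & (j < k)%N].
Proof.
case/and4P=> i8 j8 k8 nz; apply/andP; split.
  by apply: contraNneq nz => ->; rewrite (proj1 clie).
move/'forall_'forall_'forall_implyP: ctop => /(_ _ _ _ nz).
by rewrite !inordK.
Qed.

Lemma inord_eq (i j : nat) : (i < 8)%N -> (j < 8)%N -> inord i = inord j :> 'I_8 -> i = j.
Proof. by move=> i8 j8 /(congr1 val); rewrite /= !inordK. Qed.

Lemma supp_out i j k k' : supp i j k -> supp i j k' -> k = k'.
Proof.
move=> /and4P[_ _ k8 nz] /and4P[_ _ k8' nz'].
exact: inord_eq k8 k8' (nice_out cnice nz nz').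
Qed.

Lemma supp_in i j j' k : supp i j k -> supp i j' k -> j = j'.
Proof.
move=> /and4P[_ k8 _ nz] /and4P[_ k8' _ nz'].
exact: inord_eq k8 k8' (nice_in cnice nz nz').
Qed.

(** A nonzero term of a Jacobi identity must be cancelled by one of the two other cyclic terms. *)
Lemma supp_jacobi i j m r k : supp i j m -> supp m r k ->
  (exists2 m', supp j r m' & supp i m' k) \/ (exists2 m', supp i r m' & supp j m' k).
Proof.
move=> s1 s2; have /and4P[i8 j8 m8 nz1] := s1; have /and4P[_ r8 k8 nz2] := s2.
have [/existsP[n /andP[h1 h2]]|none1] :=
    boolP [exists n : 'I_8, supp j r n && supp i n k]; first by left; exists n.
have [/existsP[n /andP[h1 h2]]|none2] :=
    boolP [exists n : 'I_8, supp i r n && supp j n k]; first by right; exists n.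
have zz (x y z u v w : 'I_8) : ~~ (supp x y z && supp u v w) -> c x y z * c u v w = 0.
  by rewrite !suppE -negb_or negbK -mulf_eq0 => /eqP.
have [_ [_ /(_ (inord i) (inord j) (inord r) (inord k))]] := clie.
rewrite !big_split /= [X in X + _ + _]big1 => [|n _]; last first.
  move: none1; rewrite negb_exists => /forallP/(_ n) h.
  by apply: zz; rewrite !inordK.
rewrite [X in _ + X + _]big1 => [|n _]; last first.
  move: none2; rewrite negb_exists => /forallP/(_ n) h.
  by apply: zz; rewrite !inordK // supp_sym.
rewrite (bigD1 (inord m)) //= big1 ?addr0 ?add0r => [|n nm]; last first.
  have [->|nz] := eqVneq (c (inord i) (inord j) n) 0; first by rewrite mul0r.
  by rewrite (nice_out cnice nz nz1) eqxx in nm.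
move/eqP; rewrite mulf_eq0 (negbTE nz1) (lie_anti clie) oppr_eq0.
by rewrite (negbTE nz2).
Qed.

Lemma has_diagram_supp : has_diagram c (diagram supp 8).
Proof.
have md := mem_diagram supp_tri.
split.
- exact: uniq_diagram supp_tri _.
- by apply/allP => -[[i j] k]; rewrite md => /and3P[-> _ /and4P[_ -> -> _]].
- by move=> i j k; rewrite (mem_norm supp_sym supp_tri) ltn_ord suppE.
Qed.
End Support.

Arguments diagram : simpl never.

(** Sort the basis by height; antisymmetry gives the inequality for the second source. *)
Lemma height_topological (R : realType) (c : sconst R 8) h :
  is_lie c -> height_function c h -> exists s : 'S_8, topological (permute s c).
Proof.
move=> clie hP; pose e := sort (relpre h leq) (enum 'I_8).
have se : size e = 8 by rewrite size_sort size_enum_ord.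
have ue : uniq e by rewrite sort_uniq enum_uniq.
have s_inj : injective (fun i : 'I_8 => nth ord0 e i).
  by move=> i j /eqP; rewrite nth_uniq ?se // => /eqP/val_inj.
exists (perm s_inj); apply/'forall_'forall_'forall_implyP => i j k nz.
have mono (x y : 'I_8) : (h (perm s_inj x) < h (perm s_inj y))%N -> (x < y)%N.
  rewrite !permE; apply: contraTltn => yx; rewrite -leqNgt.
  have tr : transitive (relpre h leq) by move=> ? ? ?; apply: leq_trans.
  have tot : total (relpre h leq) by move=> ? ?; apply: leq_total.
  have rf : reflexive (relpre h leq) by move=> ? /=.
  by apply: (sorted_leq_nth tr rf ord0 (sort_sorted tot _)); rewrite ?inE -/e ?se.
by rewrite !mono //; apply: hP; [rewrite (lie_anti clie) oppr_eq0; exact: nz | exact: nz].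
Qed.

Lemma swap_ord p (i : 'I_8) : (p < 7)%N ->
  tperm (inord p) (inord p.+1) i = swap p i :> nat.
Proof.
move=> p7; rewrite /swap !eqnE.
have vp : (inord p : 'I_8) = p :> nat by rewrite inordK //; lia.
have vp' : (inord p.+1 : 'I_8) = p.+1 :> nat by rewrite inordK.
case: tpermP => [->|->|/eqP ip /eqP ip']; rewrite ?vp ?vp' ?eqxx //.
  by rewrite gtn_eqF.
have /negbTE -> : (i : nat) != p by apply: contra ip => /eqP e; rewrite -val_eqE /= vp e.
by have /negbTE -> : (i : nat) != p.+1 by apply: contra ip' => /eqP e;
  rewrite -val_eqE /= vp' e.
Qed.

(** A code is a sum over arrows that is symmetric in the two sources, so neither the order of the
    list nor the reordering by [norm] affects it. *)
Lemma codes_map_arrow l q D D' : perm_eq D' (map (map_arrow q) D) ->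
  codes l id D' = codes l q D.
Proof.
move=> pe; apply/eq_in_map => v _.
rewrite (perm_sumn (perm_map _ pe)) -map_comp; congr sumn.
apply: eq_map => -[[i j] k] /=; rewrite /map_arrow /norm /=.
by case: ifP => _; rewrite // mulnC.
Qed.

Lemma codes_swap (R : realType) (c : sconst R 8) p : (p < 7)%N ->
  is_lie c -> topological c ->
  let c' := permute (tperm (inord p) (inord p.+1)) c in topological c' ->
  codes 7 id (diagram (supp c') 8) = codes 7 (swap p) (diagram (supp c) 8).
Proof.
move=> p7 clie ctop c' c'top.
have c'lie : is_lie c' by exact: permute_lie.
pose sw := map_arrow (swap p).
have swap8 v : (v < 8)%N -> (swap p v < 8)%N.
  by move=> v8; rewrite -(swap_ord (Ordinal v8) p7).
have suppS i j k : supp c' i j k = supp c (swap p i) (swap p j) (swap p k).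
  have lt8 v : (swap p v < 8)%N = (v < 8)%N.
    by apply/idP/idP => /swap8; rewrite ?swapK.
  rewrite /supp !lt8; have [i8|] := boolP (i < 8)%N => //=.
  have [j8|] := boolP (j < 8)%N => //=; have [k8|//] := boolP (k < 8)%N => /=.
  have E v : (v < 8)%N -> tperm (inord p) (inord p.+1) (inord v) = inord (swap p v) :> 'I_8.
    by move=> v8; apply: val_inj; rewrite /= swap_ord // !inordK ?swap8.
  by rewrite /c' /permute !E.
have pe : perm_eq (diagram (supp c') 8) (map sw (diagram (supp c) 8)).
  have inj : injective (swap p) by exact: inv_inj (swapK p).
  have sw_inj : {in diagram (supp c) 8 &, injective sw}.
    move=> [[i j] k] [[i' j'] k']; rewrite !(mem_diagram (supp_tri clie ctop)).
    move=> /and3P[ij _ _] /and3P[ij' _ _]; rewrite /sw /map_arrow /norm /=.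
    have := inj i j; have := inj i' j'.
    do 2 case: ifP => _ _; case=> /inj e1 /inj e2 /inj e3; subst => //;
      by have := ltn_trans ij ij'; rewrite ltnn.
  apply: uniq_perm.
  - exact: uniq_diagram (supp_tri c'lie c'top) _.
  - by rewrite map_inj_in_uniq // (uniq_diagram (supp_tri clie ctop)).
  have swN i j k : sw (norm i j k) = norm (swap p i) (swap p j) (swap p k).
    by rewrite {1}/norm; case: ifP => _; rewrite /sw /map_arrow //= normC.
  have mD := mem_diagram (supp_tri clie ctop).
  have mN := mem_norm (supp_sym clie) (supp_tri clie ctop).
  move=> [[i j] k]; rewrite (mem_diagram (supp_tri c'lie c'top)).
  have bnd : supp c' i j k -> (k < 8)%N by exact: supp_bound.
  apply/and3P/mapP => [[ij k8 s1]|[[[x y] z] + E]].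
    exists (norm (swap p i) (swap p j) (swap p k)); first by rewrite mN swap8 // -suppS.
    by rewrite swN !swapK /norm ij.
  rewrite mD => /and3P[xy z8 sxyz].
  have E2 : sw (x, y, z) = norm (swap p x) (swap p y) (swap p z) by [].
  have xy' : swap p x != swap p y by apply: contraTneq xy => /inj ->; rewrite ltnn.
  rewrite E2 /norm in E; have [xy2|xy2] := ltnP (swap p x) (swap p y).
    by rewrite xy2 in E; case: E => -> -> ->; rewrite suppS !swapK sxyz swap8.
  rewrite ltnNge xy2 /= in E; case: E => -> -> ->.
  rewrite suppS !swapK (supp_sym clie) sxyz swap8 //; split=> //.
  by rewrite ltn_neqAle eq_sym xy' xy2.
exact: codes_map_arrow pe.
Qed.

Lemma has_exists (T : Type) (p : pred T) s : has p s -> exists x, p x.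
Proof. by elim: s => //= x s IH /orP[px|/IH//]; exists x. Qed.

(** There are finitely many topological orders, so one has minimal codes. Transposing p and p+1
    gives another topological order when no arrow leads from p to p+1, and it has no smaller
    codes. *)
Lemma minimal_topological (R : realType) (c : sconst R 8) h :
  is_lie c -> height_function c h -> exists s : 'S_8,
    let c' := permute s c in topological c' /\
    forall p, (p < 7)%N -> (forall i, ~~ supp c' p i p.+1) ->
      lexle (codes 7 id (diagram (supp c') 8)) (codes 7 (swap p) (diagram (supp c') 8)).
Proof.
move=> clie hP; have [s0 s0P] := height_topological clie hP.
pose W s := codes 7 id (diagram (supp (permute s c)) 8).
case: (@extremumP _ _ lexle _ (fun s => topological (permute s c)) W
   lexle_refl lexle_trans lexle_total s0P) => s sP smin.
exists s => c'; split=> // p p7 np.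
pose t : 'S_8 := tperm (inord p) (inord p.+1).
have c'lie : is_lie c' by exact: permute_lie.
have E : permute t c' = permute (t * s)%g c.
  by apply: funext => i; apply: funext => j; apply: funext => k;
     rewrite /c' /permute !permM.
have ttop : topological (permute t c').
  apply/'forall_'forall_'forall_implyP => i j k nz.
  have aux (x y : 'I_8) : supp c' (t x) y (t k) -> (x < k)%N.
    move=> sxy; have := supp_tri c'lie sP sxy => /and3P[_ + _].
    rewrite /t !swap_ord // => lt.
    (* The transposition only reverses the order of p and p+1, and these are not joined by an
       arrow. *)
    have : ~~ ((swap p x == p) && (swap p k == p.+1)).
      apply: contraL sxy => /andP[/eqP ex /eqP ek].
      by rewrite /t !swap_ord // ex ek np.
    move: lt; rewrite /swap !eqnE; do ?[case: eqP => ?]; lia.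
  rewrite (aux i (t j)) ?(aux j (t i)) ?suppE //.
  by rewrite (lie_anti c'lie) oppr_eq0.
have WE : W (t * s)%g = codes 7 (swap p) (diagram (supp c') 8).
  rewrite /W -E; exact: codes_swap p7 c'lie sP ttop.
rewrite -WE; apply: (smin (t * s)%g); rewrite -E; exact: ttop.
Qed.

Lemma norm_inj x y z x' y' z' : norm x y z = norm x' y' z' ->
  z = z' /\ ((x = x' /\ y = y') \/ (x = y' /\ y = x')).
Proof. by rewrite /norm; do 2 case: ifP => _; case=> -> -> ->; auto. Qed.

(** The indicator function of the leaf is a grading that isolates its only arrow. *)
Lemma no_leaf_balanced (R : realType) (c : sconst R 8) (g : 'I_8 -> R) :
  is_lie c -> topological c -> (forall i, g i != 0) -> balanced g c ->
  no_leaf (diagram (supp c) 8).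
Proof.
move=> clie ctop gnz bal; rewrite /no_leaf everyE; apply/allP => v.
rewrite mem_iota /= => v8; rewrite eqnE; apply/negP => /eqP c1.
apply: (@isolates_false _ _ _ _ clie gnz (has_diagram_supp clie ctop) bal
  (0%N, mkseq (fun u => nat_of_bool (u == v)) 8)).
rewrite /isolates eqnE; apply/eqP; rewrite -[RHS]c1; apply: eq_in_count => -[[i j] k].
rewrite (mem_diagram (supp_tri clie ctop)) => /and3P[ij k8 s1].
have /and3P[_ ik jk] := supp_tri clie ctop s1.
have i8 := ltn_trans ik k8; have j8 := ltn_trans jk k8.
rewrite /touches /neutral !eqnE /= !nth_mkseq //.
by move: ij ik jk; case: (eqVneq k v); case: (eqVneq i v); case: (eqVneq j v) => //=; lia.
Qed.

Theorem classification (R : realType) (c : sconst R 8) (g : 'I_8 -> R) :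
  is_lie c -> nice c -> nilpotent c -> ~ abelian c -> (forall i, g i != 0) ->
  balanced g c ->
  exists s : 'S_8, exists2 e, e \in survivors & has_diagram (permute s c) e.1.
Proof.
move=> clie cnice cnil cnab gnz bal.
have [h hP] := nilpotent_height clie cnice cnil.
have [s [ctop cmin]] := minimal_topological clie hP.
set c' := permute s c in ctop cmin.
have c'lie : is_lie c' by exact: permute_lie.
have c'nice : nice c' by exact: permute_nice.
have bal' : balanced (g \o s) c' by exact: permute_balanced.
have gnz' i : (g \o s) i != 0 by exact: gnz.
have hD := has_diagram_supp c'lie ctop.
have leaf := no_leaf_balanced c'lie ctop gnz' bal'.
have Ds : diagram (supp c') 8 \in search 8.
  by apply: diagram_search; [exact: supp_sym | exact: supp_tri | exact: supp_out
    | exact: supp_in | exact: supp_jacobi | exact: leaf | exact: cmin | ].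
move/allP/(_ _ Ds): search_ok; move: hD {Ds leaf cmin}.
move: (diagram _ _) => D hD; rewrite /leaf_ok !someE.
case: (boolP (nilp D)) => [/nilP D0 _|_].
  case: cnab => i j k; apply/eqP; case: hD => _ _ /(_ ((s^-1)%g i) ((s^-1)%g j) ((s^-1)%g
    k)).
  by rewrite /c' /permute !permKV D0 => /negbFE.
have [/hasP[w _ iw]|_] := boolP (has (isolates D) gradings).
  by case: (isolates_false c'lie gnz' hD bal' iw).
have [/has_exists[C rC]|_] := boolP (has (refutes D) certificates).
  by case: (refutes_false c'lie c'nice gnz' hD bal' rC).
case: hasP => // -[[r q] eS /andP[pq pr]] _.
have [uD bD suppD] := hD.
have sq : size q = 8 by rewrite -(perm_size pq).
have uq : uniq q by rewrite -(perm_uniq pq) iota_uniq.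
have q8 (i : 'I_8) : (nth 0 q i < 8)%N.
  have : nth 0 q i \in q by rewrite mem_nth ?sq.
  by rewrite -(perm_mem pq) mem_iota.
pose f (i : 'I_8) : 'I_8 := Ordinal (q8 i).
have f_inj : injective f.
  by move=> i j /(congr1 val) /= /eqP; rewrite nth_uniq ?sq // => /eqP/val_inj.
pose t := perm f_inj.
have tE (i : 'I_8) : t i = nth 0 q i :> nat by rewrite permE.
(* [permute] pulls indices back, so the relabelling of the nodes enters through its inverse. *)
exists (t^-1 * s)%g; exists (r, q) => //.
move/allP/(_ _ eS): survivors_wf => /andP[ur br]; split=> // i j k.
have -> : permute (t^-1 * s)%g c i j k = c' ((t^-1)%g i) ((t^-1)%g j) ((t^-1)%g k).
  by rewrite /c' /permute !permM.
have mN (x y z : nat) : map_arrow (nth 0 q) (norm x y z) =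
    norm (nth 0 q x) (nth 0 q y) (nth 0 q z).
  by rewrite {1}/norm; case: ifP => _; rewrite /map_arrow //= normC.
rewrite suppD -(perm_mem pr); apply/idP/mapP => [inD|[[[x y] z] inD]].
  by eexists; first exact: inD; rewrite mN -!tE !permKV.
have [xy x8 y8 z8] := diagram_bound hD inD.
have -> : map_arrow (nth 0 q) (x, y, z) = norm (t (Ordinal x8)) (t (Ordinal y8)) (t
  (Ordinal z8)).
  by rewrite !tE.
case/norm_inj => /val_inj -> e; have inN : norm x y z \in D by rewrite /norm xy.
by case: e => -[/val_inj -> /val_inj ->]; rewrite !permK // normC.
Qed.

(** * The remaining diagrams *)

Section Edges.
Variables (R : realType) (D : seq arrow) (y : arrow -> R) (gam : nat -> R).

Definition edge_weight (a : arrow) : R :=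
  let: (i, j, k) := a in y a ^+ 2 * gam k / (gam i * gam j).

(** Structure constants recovered by antisymmetry from their values on the arrows. *)
Definition signed i j k : R :=
  if some (arrow_eq (norm i j k)) D then
    if (i < j)%N then y (i, j, k) else - y (j, i, k)
  else 0.

(** A [foldr] over an explicit list unfolds by simplification to a polynomial in the values of [y],
    which a big operator would not do. *)
Definition jacobi_sum i j k l : R :=
  foldr (fun m s => signed j k m * signed i m l + signed k i m * signed j m l
                    + signed i j m * signed k m l + s) 0 (iota 0 8).

Definition vertex_sum (X : arrow -> R) (v : nat) : R :=
  foldr (fun a s => let: (i, j, k) := a in
    (if eqn k v then X a else 0) - (if eqn i v then X a else 0)
    - (if eqn j v then X a else 0) + s) 0 D.

Definition flat_edges (X : arrow -> R) : Prop :=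
  (forall v, (v < 8)%N -> vertex_sum X v = 0).

Definition jacobi_edges : Prop := forall i j k l,
  (i < 8)%N -> (j < 8)%N -> (k < 8)%N -> (l < 8)%N -> jacobi_sum i j k l = 0.

End Edges.

Lemma vertex_sumE (R : realType) (D : seq arrow) (X : arrow -> R) v :
  vertex_sum D X v =
  \sum_(a <- D) ((a.2 == v)%:R - (a.1.1 == v)%:R - (a.1.2 == v)%:R) * X a.
Proof.
elim: D => [|[[i j] k] D IH]; first by rewrite big_nil.
rewrite big_cons -IH /= !eqnE.
case: (k == v); case: (i == v); case: (j == v); rewrite /=; ring.
Qed.

Definition arrow_const (R : realType) (c : sconst R 8) (a : arrow) : R :=
  c (inord a.1.1) (inord a.1.2) (inord a.2).

Section Concrete.
Variables (R : realType) (c : sconst R 8) (D : seq arrow).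
Hypotheses (clie : is_lie c) (cD : has_diagram c D).
Local Notation y := (arrow_const c).

Lemma arrow_const_nz a : a \in D -> y a != 0.
Proof. by case: a => [[i j] k] /(diagram_nz cD). Qed.

Lemma signedE (i j k : 'I_8) : signed D y i j k = c i j k.
Proof.
rewrite /signed some_mem; have [_ _ suppD] := cD; rewrite -suppD.
case: eqVneq => [->|_] //=; rewrite /arrow_const /= !inord_val.
by case: ifP => // _; rewrite [RHS](lie_anti clie).
Qed.

Lemma diagram_jacobi : jacobi_edges D y.
Proof.
move=> i j k l i8 j8 k8 l8; have [_ [_ jac]] := clie.
rewrite -[RHS](jac (Ordinal i8) (Ordinal j8) (Ordinal k8) (Ordinal l8)).
under [RHS]eq_bigr => m _ do rewrite -!signedE /=.
rewrite -(big_mkord xpredT (fun m => signed D y j k m * signed D y i m l +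
  signed D y k i m * signed D y j m l + signed D y i j m * signed D y k m l)).
by rewrite unlock.
Qed.

Lemma diagram_flat (g : 'I_8 -> R) : balanced g c ->
  flat_edges D (edge_weight y (fun v => g (inord v))).
Proof.
move=> bal v v8; rewrite vertex_sumE.
rewrite -[RHS](balanced_graded clie cD bal (fun u => (u == v :> nat)%:R)).
apply: eq_big_seq => -[[i j] k] /(diagram_bound cD)[_ i8 j8 k8] /=.
by rewrite !inordK.
Qed.

End Concrete.

Arguments edge_weight : simpl never.

Ltac expand D := rewrite /jacobi_sum /signed /vertex_sum /D /=
  ?(mul0r, mulr0, oppr0, add0r, addr0, sub0r, subr0).

(** * The seven diagrams excluded by hand *)

Section Excluded.
Variables (R : realType) (y : arrow -> R) (gam : nat -> R).
Hypothesis gam_nz : forall v, gam v != 0.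
Local Notation X := (edge_weight y gam).

Lemma edge_weight_nz a : y a != 0 -> X a != 0.
Proof.
case: a => [[i j] k] yn; rewrite /edge_weight.
by rewrite !mulf_neq0 ?invr_neq0 ?mulf_neq0.
Qed.

Lemma cancel_nz (a b : R) : a != 0 -> a * b = 0 -> b = 0.
Proof. by move=> an /eqP; rewrite mulf_eq0 (negbTE an) => /eqP. Qed.

(** The metric factor does not depend on the intermediate node m, so relations between products of
    structure constants become relations between products of weights. *)
Lemma edge_pairL i j m k l : X (i, j, m) * X (k, m, l) =
  (y (i, j, m) * y (k, m, l)) ^+ 2 * (gam l / (gam i * gam j * gam k)).
Proof. by rewrite /edge_weight; field; rewrite !gam_nz. Qed.

Lemma edge_pairR i j m k l : X (i, j, m) * X (m, k, l) =
  (y (i, j, m) * y (m, k, l)) ^+ 2 * (gam l / (gam i * gam j * gam k)).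
Proof. by rewrite /edge_weight; field; rewrite !gam_nz. Qed.

(** By balance all six weights are x or -x, with three minus signs, so their product is -x^6. It is
    also a square, since every metric coefficient enters it with an even exponent. *)
Lemma E1_excluded : {in E1, forall a, y a != 0} -> flat_edges E1 X -> False.
Proof.
move=> nz F.
have := F 1 isT; have := F 2 isT; have := F 3 isT; have := F 4 isT; have := F 5 isT.
expand E1 => f5 f4 f3 f2 f1.
have x0 : X (0, 1, 4) != 0 by exact/edge_weight_nz/nz.
have sq : X (0, 1, 4) * X (0, 2, 5) * X (0, 4, 6) * X (1, 3, 6) * X (0, 5, 7) * X (2, 3, 7)
  = (y (0, 1, 4) * y (0, 2, 5) * y (0, 4, 6) * y (1, 3, 6) * y (0, 5, 7) * y (2, 3, 7)
     * (gam 6 * gam 7) / (gam 0 ^+ 2 * gam 1 * gam 2 * gam 3)) ^+ 2.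
  by rewrite /edge_weight; field; rewrite !gam_nz.
have [x ex] : exists x, X (0, 1, 4) = x by exists (X (0, 1, 4)).
rewrite ex in x0.
have e1 : X (0, 2, 5) = - x by lra.
have e2 : X (0, 4, 6) = x by lra.
have e3 : X (1, 3, 6) = - x by lra.
have e4 : X (0, 5, 7) = - x by lra.
have e5 : X (2, 3, 7) = x by lra.
rewrite ex e1 e2 e3 e4 e5 in sq.
have := sqr_ge0 (y (0, 1, 4) * y (0, 2, 5) * y (0, 4, 6) * y (1, 3, 6) * y (0, 5, 7) * y
  (2, 3, 7)
     * (gam 6 * gam 7) / (gam 0 ^+ 2 * gam 1 * gam 2 * gam 3)).
rewrite -sq; have : 0 < (x * x * x) ^+ 2 by rewrite exprn_even_gt0 //= !mulf_neq0.
lra.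
Qed.

(** Up to the nonzero factors y067, y025, y014, the three two-term identities read A = B, B = C and
    A = -C for monomials A, B, C; hence A = 0. *)
Lemma E2_excluded : {in E2, forall a, y a != 0} -> jacobi_edges E2 y -> False.
Proof.
move=> nz J.
have := J 0 1 2 6 isT isT isT isT; expand E2 => J1.
have := J 0 1 5 7 isT isT isT isT; expand E2 => J2.
have := J 0 2 4 7 isT isT isT isT; expand E2 => J3.
have n1 : y (0, 1, 4) * y (2, 4, 6) * y (0, 6, 7) != 0 by rewrite !mulf_neq0 ?nz.
have K1 := congr1 ( *%R (y (0, 6, 7))) J1.
have K2 := congr1 ( *%R (y (0, 2, 5))) J2.
have K3 := congr1 ( *%R (y (0, 1, 4))) J3.
move/eqP: n1; apply; lra.
Qed.

(** As for [E1]: six of the weights are chosen so that their product is a square, while balance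
    makes it -(x^2 z)^2. *)
Lemma E3_excluded : {in E3, forall a, y a != 0} -> flat_edges E3 X -> False.
Proof.
move=> nz F.
have := F 0 isT; have := F 1 isT; have := F 2 isT; have := F 3 isT; have := F 4 isT.
have := F 5 isT; have := F 6 isT; have := F 7 isT.
expand E3 => f7 f6 f5 f4 f3 f2 f1 f0.
have x0 : X (0, 1, 4) != 0 by exact/edge_weight_nz/nz.
have x1 : X (0, 4, 5) != 0 by exact/edge_weight_nz/nz.
set s := y (0, 1, 4) * y (0, 4, 5) * y (1, 2, 5) * y (0, 3, 6) * y (0, 6, 7) * y (2, 3, 7)
     * (gam 5 * gam 7) / (gam 0 ^+ 2 * gam 1 * gam 2 * gam 3).
have sq : X (0, 1, 4) * X (0, 4, 5) * X (1, 2, 5) * X (0, 3, 6) * X (0, 6, 7) * X (2, 3, 7)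
  = s ^+ 2.
  by rewrite /s /edge_weight; field; rewrite !gam_nz.
have [x ex] : exists x, X (0, 1, 4) = x by exists (X (0, 1, 4)).
have [z ez] : exists z, X (0, 4, 5) = z by exists (X (0, 4, 5)).
rewrite ex in x0; rewrite ez in x1.
have e1 : X (1, 2, 5) = - x by lra.
have e2 : X (0, 3, 6) = - x by lra.
have e3 : X (0, 6, 7) = - z by lra.
have e4 : X (2, 3, 7) = x by lra.
rewrite ex ez e1 e2 e3 e4 in sq.
have := sqr_ge0 s.
rewrite -sq; have : 0 < (x * x * z) ^+ 2 by rewrite exprn_even_gt0 //= !mulf_neq0.
lra.
Qed.

(** Two products of six weights are squares. By balance they are the negative cubes of (x + z) z and
    (x + z) x, so both of these are at most 0, and so is their sum (x + z)^2. But x + z is a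
    weight. *)
Lemma E4_excluded : {in E4, forall a, y a != 0} -> flat_edges E4 X -> False.
Proof.
move=> nz F.
have := F 0 isT; have := F 1 isT; have := F 2 isT; have := F 3 isT; have := F 4 isT.
have := F 5 isT; have := F 6 isT; have := F 7 isT.
expand E4 => f7 f6 f5 f4 f3 f2 f1 f0.
have n1 : X (2, 4, 6) != 0 by exact/edge_weight_nz/nz.
have n2 : X (0, 3, 6) != 0 by exact/edge_weight_nz/nz.
have n3 : X (0, 1, 3) != 0 by exact/edge_weight_nz/nz.
set s := y (0, 1, 3) * y (0, 2, 4) * y (0, 3, 6) * y (1, 5, 6) * y (0, 4, 7) * y (2, 5, 7)
     * (gam 6 * gam 7) / (gam 0 ^+ 2 * gam 1 * gam 2 * gam 5).
have sq : X (0, 1, 3) * X (0, 2, 4) * X (0, 3, 6) * X (1, 5, 6) * X (0, 4, 7) * X (2, 5, 7)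
  = s ^+ 2.
  by rewrite /s /edge_weight; field; rewrite !gam_nz.
set t := y (0, 1, 3) * y (1, 2, 5) * y (1, 5, 6) * y (2, 4, 6) * y (0, 4, 7) * y (1, 3, 7)
     * (gam 6 * gam 7) / (gam 0 * gam 1 ^+ 2 * gam 2 * gam 4).
have tq : X (0, 1, 3) * X (1, 2, 5) * X (1, 5, 6) * X (2, 4, 6) * X (0, 4, 7) * X (1, 3, 7)
  = t ^+ 2.
  by rewrite /t /edge_weight; field; rewrite !gam_nz.
have [x ex] : exists x, X (2, 4, 6) = x by exists (X (2, 4, 6)).
have [z ez] : exists z, X (0, 3, 6) = z by exists (X (0, 3, 6)).
rewrite ex in n1; rewrite ez in n2.
have e0 : X (0, 1, 3) = x + z by lra.
have e1 : X (0, 2, 4) = - z by lra.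
have e2 : X (1, 5, 6) = - (x + z) by lra.
have e3 : X (0, 4, 7) = - (x + z) by lra.
have e4 : X (2, 5, 7) = z by lra.
have e5 : X (1, 2, 5) = - x by lra.
have e6 : X (1, 3, 7) = x by lra.
rewrite ez e0 e1 e2 e3 e4 in sq; rewrite ex e0 e5 e2 e3 e6 in tq.
rewrite e0 in n3.
have := sqr_ge0 s; have := sqr_ge0 t; rewrite -sq -tq.
have -> : (x + z) * - x * - (x + z) * x * - (x + z) * x = - ((x + z) * x) ^+ 3 by ring.
have -> : (x + z) * - z * z * - (x + z) * - (x + z) * z = - ((x + z) * z) ^+ 3 by ring.
rewrite !oppr_ge0 !exprn_odd_le0 // => h1 h2.
have : 0 < (x + z) ^+ 2 by rewrite exprn_even_gt0.
lra.
Qed.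

(** As for [E2]: three two-term identities combine to say that a nonzero monomial equals its own
    negative. *)
Lemma E5_excluded : {in E5, forall a, y a != 0} -> jacobi_edges E5 y -> False.
Proof.
move=> nz J.
have := J 0 1 3 6 isT isT isT isT; expand E5 => J1.
have := J 0 1 4 7 isT isT isT isT; expand E5 => J2.
have := J 0 2 3 7 isT isT isT isT; expand E5 => J3.
have n1 : y (0, 1, 2) * y (2, 3, 6) * y (0, 6, 7) != 0 by rewrite !mulf_neq0 ?nz.
have K1 := congr1 ( *%R (y (0, 6, 7))) J1.
have K2 := congr1 ( *%R (y (0, 3, 4))) J2.
have K3 := congr1 ( *%R (y (0, 1, 2))) J3.
move/eqP: n1; apply; lra.
Qed.

(* [Q] is the product of two terms of a three-term Jacobi identity, up to the factor
   that turns their squares into the products [A] and [G] of weights. *)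
Lemma E6_polynomials (x u v z Q : R) (p := z + u) (A := v * (v + p)) (G := x * (x + u)) :
  x != 0 -> u != 0 -> p != 0 -> x + u != 0 ->
  (v + p) * u = - (x * p) -> (x + v + p) ^+ 2 = A + G - 2 * Q ->
  z ^+ 2 * (v + p) = - (p * (A + G + 2 * Q)) -> Q ^+ 2 = A * G -> False.
Proof.
move=> x0 u0 p0 xu0 e1 e2 e3 eQ.
have uv : u * v = - (p * (x + u)) by lra.
have h1 : x * z ^+ 2 = u * (A + G + 2 * Q).
  apply: (mulfI p0); have := congr1 ( *%R u) e3.
  have -> : u * (z ^+ 2 * (v + p)) = z ^+ 2 * ((v + p) * u) by ring.
  rewrite e1; lra.
have h2 : u ^+ 2 * A = p ^+ 2 * x * (x + u).
  have -> : u ^+ 2 * A = (u * v) * ((v + p) * u) by rewrite /A; ring.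
  by rewrite uv e1; ring.
have h3 : u * (x + v + p) = - (x * z).
  have -> : u * (x + v + p) = u * x + (v + p) * u by ring.
  by rewrite e1 /p; ring.
(* In this combination the terms in [Q] cancel. *)
have h4 : z ^+ 2 = 2 * (p ^+ 2 + u ^+ 2).
  apply: (mulfI xu0); apply: (mulfI x0).
  have -> : x * ((x + u) * z ^+ 2) = (x * z) ^+ 2 + u * (x * z ^+ 2) by ring.
  have -> : (x * z) ^+ 2 = (u * (x + v + p)) ^+ 2 by rewrite h3 sqrrN.
  rewrite exprMn e2 h1.
  have -> : u ^+ 2 * (A + G - 2 * Q) + u * (u * (A + G + 2 * Q)) =
    2 * (u ^+ 2 * A + u ^+ 2 * G) by ring.
  by rewrite h2 /G; ring.
(* As z = p - u, the relation [h4] says (p + u)^2 = 0. *)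
have pu : p = - u.
  apply/eqP; rewrite -addr_eq0 -sqrf_eq0.
  have : z = p - u by rewrite /p; ring.
  by move=> ez; rewrite ez in h4; apply/eqP; lra.
have ev : v = x + u.
  apply: (mulfI u0); rewrite uv pu; ring.
have eA : A = G by rewrite /A /G ev pu; ring.
have eQ1 : Q = x * (u - x).
  by move: e2; rewrite eA /G ev pu => e2; apply: (@mulfI _ 2); [rewrite pnatr_eq0 | lra].
have := eQ; rewrite eA eQ1 /G => eQ2.
have : 4 * (x ^+ 2 * (x * u)) = 0 by lra.
by move/eqP; rewrite !mulf_eq0 ?pnatr_eq0 /= (negbTE x0) (negbTE u0).
Qed.

(** The Jacobi identity for e_0, e_1, e_2 has the terms [al], [ga] and their difference up to sign;
    the two others lead to the sum [al + ga]. Squaring gives products of weights, and balance leaves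
    four parameters x, u, v, z. The mixed term of the squares is [Q]. *)
Lemma E6_excluded : {in E6, forall a, y a != 0} -> jacobi_edges E6 y ->
  flat_edges E6 X -> False.
Proof.
move=> nz J F.
have := J 0 1 2 6 isT isT isT isT; expand E6 => J1.
have := J 0 1 4 7 isT isT isT isT; expand E6 => J2.
have := J 0 2 3 7 isT isT isT isT; expand E6 => J3.
have := F 0 isT; have := F 1 isT; have := F 2 isT; have := F 3 isT; have := F 4 isT.
have := F 5 isT; have := F 6 isT; have := F 7 isT.
expand E6 => f7 f6 f5 f4 f3 f2 f1 f0.
pose kap := gam 6 / (gam 0 * gam 1 * gam 2).
pose al := y (0, 1, 3) * y (2, 3, 6); pose ga := y (0, 2, 4) * y (1, 4, 6).
have xnz a : a \in E6 -> X a != 0 by move=> /nz/edge_weight_nz.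
have n01 := xnz (0, 1, 3) isT; have n02 := xnz (0, 2, 4) isT.
have n14 := xnz (1, 4, 6) isT; have n34 := xnz (3, 4, 7) isT.
have n06 := xnz (0, 6, 7) isT.
have y01 : y (0, 1, 3) != 0 by exact: nz.
have pA : X (0, 1, 3) * X (2, 3, 6) = al ^+ 2 * kap by rewrite edge_pairL.
have pG : X (0, 2, 4) * X (1, 4, 6) = ga ^+ 2 * kap.
  by rewrite edge_pairL /kap; congr (_ * _); field; rewrite !gam_nz.
have pT : X (1, 2, 5) * X (0, 5, 6) = (ga - al) ^+ 2 * kap.
  rewrite edge_pairL (_ : y (1, 2, 5) * y (0, 5, 6) = ga - al); last by rewrite /ga /al;
    lra.
  by congr (_ * _); rewrite /kap; field; rewrite !gam_nz.
have p2 : X (0, 1, 3) * X (3, 4, 7) = X (1, 4, 6) * X (0, 6, 7).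
  rewrite edge_pairR edge_pairL (_ : y (1, 4, 6) * _ = y (0, 1, 3) * y (3, 4, 7));
    last by lra.
  by congr (_ * _); field; rewrite !gam_nz.
have p3 : X (0, 3, 5) * X (2, 5, 7) * X (0, 1, 3) = X (0, 6, 7) * ((al + ga) ^+ 2 * kap).
  have e : y (0, 3, 5) * y (2, 5, 7) * y (0, 1, 3) = y (0, 6, 7) * (al + ga).
    have h := congr1 ( *%R (y (0, 2, 4))) J2; have h3 := congr1 ( *%R (y (0, 1, 3))) J3.
    rewrite /al /ga; lra.
  rewrite edge_pairL /edge_weight /kap.
  transitivity ((y (0, 3, 5) * y (2, 5, 7) * y (0, 1, 3)) ^+ 2 * gam 7 / (gam 0 ^+ 2 *
    gam 1 * gam 2)).
    by field; rewrite !gam_nz.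
  by rewrite e; field; rewrite !gam_nz.
have [x ex] : exists x, X (1, 4, 6) = x by exists (X (1, 4, 6)).
have [u eu] : exists u, X (3, 4, 7) = u by exists (X (3, 4, 7)).
have [v ev] : exists v, X (2, 3, 6) = v by exists (X (2, 3, 6)).
have [z ez] : exists z, X (2, 5, 7) = z by exists (X (2, 5, 7)).
have e1 : X (0, 1, 3) = v + (z + u) by lra.
have e2 : X (0, 2, 4) = x + u by lra.
have e3 : X (0, 3, 5) = z by lra.
have e4 : X (1, 2, 5) = - (x + v + (z + u)) by lra.
have e5 : X (0, 5, 6) = - (x + v + (z + u)) by lra.
have e6 : X (0, 6, 7) = - (z + u) by lra.
rewrite ?e1 ?e2 ?e3 ?e4 ?e5 ?e6 ?ex ?eu ?ev ?ez in pA pG pT p2 p3 n01 n02 n14 n34 n06.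
apply: (@E6_polynomials x u v z (al * ga * kap)) => //.
- by rewrite -oppr_eq0.
- lra.
- lra.
- have hA := congr1 ( *%R (z + u)) pA; have hG := congr1 ( *%R (z + u)) pG; lra.
- by transitivity ((al ^+ 2 * kap) * (ga ^+ 2 * kap)); [ring | rewrite -pA -pG; ring].
Qed.

(** Balance and the first two-term identity reduce all weights in the second to X_146, X_157 and
    X_247; it then says X_146 X_157 = 0. *)
Lemma E7_excluded : {in E7, forall a, y a != 0} -> jacobi_edges E7 y ->
  flat_edges E7 X -> False.
Proof.
move=> nz J F.
have := J 0 1 2 5 isT isT isT isT; expand E7 => J1.
have := J 0 2 3 7 isT isT isT isT; expand E7 => J2.
have := F 0 isT; have := F 1 isT; have := F 2 isT; have := F 3 isT; have := F 4 isT.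
have := F 5 isT; have := F 6 isT; have := F 7 isT.
expand E7 => f7 f6 f5 f4 f3 f2 f1 f0.
have xnz a : a \in E7 -> X a != 0 by move=> /nz/edge_weight_nz.
have p1 : X (0, 2, 3) * X (1, 3, 5) = X (1, 2, 4) * X (0, 4, 5).
  rewrite !edge_pairL (_ : y (1, 2, 4) * _ = y (0, 2, 3) * y (1, 3, 5)); last by lra.
  by congr (_ * _); field; rewrite !gam_nz.
have p2 : X (0, 3, 4) * X (2, 4, 7) = X (2, 3, 6) * X (0, 6, 7).
  rewrite !edge_pairL (_ : y (2, 3, 6) * _ = y (0, 3, 4) * y (2, 4, 7)); last by lra.
  by congr (_ * _); field; rewrite !gam_nz.
have n02 := xnz (0, 2, 3) isT.
have e1 : X (1, 2, 4) = - X (0, 2, 3) by lra.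
rewrite e1 in p1.
have e2 : X (1, 3, 5) + X (0, 4, 5) = 0 by apply: (cancel_nz n02); lra.
have e3 : X (0, 6, 7) = - (X (1, 5, 7) + X (2, 4, 7)) by lra.
have e4 : X (0, 3, 4) = X (1, 4, 6) + X (1, 5, 7) + X (2, 4, 7) by lra.
have e5 : X (2, 3, 6) = - (X (1, 4, 6) + X (2, 4, 7)) by lra.
have : X (1, 4, 6) * X (1, 5, 7) != 0 by rewrite mulf_neq0 ?xnz.
by move/eqP; apply; rewrite e3 e4 e5 in p2; lra.
Qed.

End Excluded.

(** * Normal forms *)

Lemma monomial_equiv (R : realType) n (c d : sconst R n) (s : 'S_n) (f : 'I_n -> R) :
  (forall i, f i != 0) ->
  (forall i j k, f k * permute s c i j k = f i * f j * d i j k) -> nice_equiv c d.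
Proof.
move=> fnz fP; pose F : 'M[R]_n := diag_mx (\row_i f i) *m perm_mx s.
have FE k j : F k j = if s k == j then f k else 0.
  by rewrite /F mul_diag_mx !mxE; case: eqP => _; rewrite ?mulr1 ?mulr0.
have FV k j : F k j = if k == (s^-1)%g j then f k else 0.
  by rewrite FE -(inj_eq (@perm_inj _ (s^-1)%g)) permK.
exists F; split; [|split].
- rewrite unitmx_mul unitmx_perm andbT unitmxE det_diag unitfE.
  by apply/prodf_neq0 => i _; rewrite mxE.
- by move=> j; exists ((s^-1)%g j) => k /negbTE kj; rewrite FV kj.
move=> i j k; rewrite (bigD1 (s k)) //= big1 ?addr0 => [|m /negbTE mk]; last first.
  by rewrite FE eq_sym mk mul0r.
rewrite (bigD1 ((s^-1)%g i)) //= [X in _ + X]big1 ?addr0 => [|p /negbTE pi]; last first.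
  by apply: big1 => q _; rewrite FV pi !mul0r.
rewrite (bigD1 ((s^-1)%g j)) //= [X in _ + X]big1 ?addr0 => [|q /negbTE qj]; last first.
  by rewrite (FV q) qj mulr0 mul0r.
by rewrite !FV permK !eqxx -fP /permute !permKV.
Qed.

(** An invertible matrix whose columns have one nonzero entry each is monomial: two columns
    supported in the same row would be proportional. *)
Lemma equiv_monomial (R : realType) n (c d : sconst R n) : nice_equiv c d ->
  exists s : 'S_n, exists2 f : 'I_n -> R, (forall i, f i != 0) &
  forall i j k, f k * permute s c i j k = f i * f j * d i j k.
Proof.
case=> F [Fu [Fmono Fhom]].
have [h hP] := fin_all_exists Fmono.
have inv i j : invmx F i (h j) * F (h j) j = (i == j)%:R.
  have := congr1 (fun M : 'M_n => M i j) (mulVmx Fu); rewrite !mxE => <-.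
  by rewrite (bigD1 (h j)) //= big1 ?addr0 // => k /hP ->; rewrite mulr0.
have Fnz j : F (h j) j != 0.
  by apply: contra_neq (oner_neq0 R) => F0; have := inv j j; rewrite F0 mulr0 eqxx => /esym.
have h_inj : injective h.
  move=> j j' hj; apply/eqP; apply: contraT => jj'.
  have := inv j j'; rewrite -hj (negbTE jj') => /eqP; rewrite mulf_eq0 => /orP[|].
    by move=> /eqP G0; have := inv j j; rewrite G0 mul0r eqxx => /esym/eqP;
      rewrite oner_eq0.
  by rewrite hj (negbTE (Fnz j')).
pose s : 'S_n := (perm h_inj)^-1%g.
have hs k : h (s k) = k by rewrite -[h _](permE h_inj) permKV.
have Fs k m : F k m = if m == s k then F k (s k) else 0.
  case: eqVneq => [->//|mk]; apply: hP; apply: contraNneq mk => ->.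
  by rewrite -[h m](permE h_inj) /s permK.
exists s, (fun k => F k (s k)) => [k|i j k]; first by rewrite -{1}(hs k).
have := Fhom (s i) (s j) k; rewrite (bigD1 (s k)) //= big1 ?addr0 => [->|m /negbTE mk];
  last first.
  by rewrite Fs mk mul0r.
rewrite (bigD1 i) //= [X in _ + X]big1 ?addr0 => [|p pi]; last first.
  by apply: big1 => q _; rewrite Fs (inj_eq (@perm_inj _ s)) eq_sym (negbTE pi) !mul0r.
rewrite (bigD1 j) //= [X in _ + X]big1 ?addr0 // => q qj.
by rewrite (Fs q) (inj_eq (@perm_inj _ s)) eq_sym (negbTE qj) mulr0 mul0r.
Qed.

(** Passes from indices counted from 1 to indices counted from 0; [proper_form] makes the
    predecessors faithful. *)
Definition form_arrow (R : realType) (t : R * nat * nat * nat) : arrow :=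
  (t.1.1.2.-1, t.1.2.-1, t.2.-1).

Definition form_coef (R : realType) (l : seq (R * nat * nat * nat)) (a : arrow) : R :=
  foldr (fun t s => if arrow_eq (form_arrow t) a then t.1.1.1 else s) 0 l.

Definition proper_form (R : realType) (t : R * nat * nat * nat) : bool :=
  [&& (0 < t.1.1.2)%N, (t.1.1.2 < t.1.2)%N & (0 < t.2)%N].

Arguments arrow_eq : simpl never.
Arguments form_arrow : simpl never.

(** Uniqueness of the arrows matters because [of_forms] adds repeated entries, whereas [form_coef]
    takes the first. *)
Lemma of_formsE (R : realType) n (l : seq (R * nat * nat * nat)) (p q r : 'I_n) :
  uniq (map (@form_arrow R) l) -> all (@proper_form R) l ->
  of_forms l p q r = signed (map (@form_arrow R) l) (fun a => - form_coef l a) p q r.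
Proof.
move=> ul pl; rewrite /of_forms /signed.
suff -> : \sum_(t <- l) (if t.2 == r.+1 then
           (if (t.1.1.2 == p.+1) && (t.1.2 == q.+1) then t.1.1.1
            else if (t.1.1.2 == q.+1) && (t.1.2 == p.+1) then - t.1.1.1
            else 0) else 0) =
   if some (arrow_eq (norm p q r)) (map (@form_arrow R) l) then
     if (p < q)%N then form_coef l (p : nat, q : nat, r : nat)
     else - form_coef l (q : nat, p : nat, r : nat) else 0.
  by case: ifP => _; rewrite ?oppr0 //; case: ifP.
elim: l ul pl => [|[[[a i] j] k] l IH] /=; first by rewrite big_nil.
case/andP => nt ul /andP[/and3P[/= i0 ij k0] pl].
rewrite big_cons {}IH //= some_mem arrow_eqE.
case: i i0 ij nt => // i _; case: k k0 => // k _; case: j => // j ij nt.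
have fE : form_arrow (a, i.+1, j.+1, k.+1) = (i, j, k) by [].
rewrite fE in nt *; rewrite !eqSS !arrow_eqE.
have [pq|qp|pq] := ltngtP p q; rewrite /norm ?pq ?ltnn.
- have -> : (i == q) && (j == p) = false.
    by apply/negP => /andP[/eqP iq /eqP jp]; move: ij; rewrite iq jp ltnNge ltnW.
  have -> : ((p : nat, q : nat, r : nat) == (i, j, k)) = (k == r) && ((i == p) && (j == q)).
    by rewrite eq_sym !xpair_eqE andbC.
  have -> : ((i, j, k) == (p : nat, q : nat, r : nat)) = (k == r) && ((i == p) && (j == q)).
    by rewrite !xpair_eqE andbC.
  have [kr|_] := eqVneq k r; last by rewrite /= add0r.
  have [/andP[/eqP ip /eqP jq]|_] := boolP ((i == p) && (j == q)); last by rewrite /= add0r.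
  by move: nt; rewrite ip jq kr => /negbTE ->; rewrite addr0.
- rewrite ltnNge (ltnW qp) /=.
  have -> : (i == p) && (j == q) = false.
    by apply/negP => /andP[/eqP iq /eqP jp]; move: ij; rewrite iq jp ltnNge ltnW.
  have -> : ((q : nat, p : nat, r : nat) == (i, j, k)) = (k == r) && ((i == q) && (j == p)).
    by rewrite eq_sym !xpair_eqE andbC.
  have -> : ((i, j, k) == (q : nat, p : nat, r : nat)) = (k == r) && ((i == q) && (j == p)).
    by rewrite !xpair_eqE andbC.
  have [kr|_] := eqVneq k r; last by rewrite /= add0r.
  have [/andP[/eqP ip /eqP jq]|_] := boolP ((i == q) && (j == p)); last by rewrite /= add0r.
  by move: nt; rewrite ip jq kr => /negbTE ->; rewrite addr0.
have nij x : (i == x) && (j == x) = false.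
  by apply/negP => /andP[/eqP ix /eqP jx]; rewrite ix jx ltnn in ij.
have nl : ((p : nat, p : nat, r : nat) \in [seq form_arrow i | i <- l]) = false.
  apply/negP => /mapP[t /(allP pl)]; rewrite /proper_form /form_arrow.
  by move=> /and3P[t0 tlt _] [e1 e2 _]; lia.
rewrite -pq nl [X in if X then true else _]eq_sym !xpair_eqE !nij /=.
by rewrite !if_same addr0.
Qed.

Section Rescaling.
Variables (R : realType) (l : seq (R * nat * nat * nat)) (y : arrow -> R).
Local Notation D := (map (@form_arrow R) l).

Definition rescales (phi : seq R) : bool :=
  all (fun v => nth 0 phi v != 0) (iota 0 8) &&
  all (fun a : arrow => let: (i, j, k) := a in
    nth 0 phi k * y a == nth 0 phi i * nth 0 phi j * - form_coef l a) D.

Definition proper_forms : bool := uniq D && all (@proper_form R) l.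

Lemma rescales_signed phi (i j k : nat) : (i < 8)%N -> (j < 8)%N -> rescales phi ->
  nth 0 phi k * signed D y i j k =
  nth 0 phi i * nth 0 phi j * signed D (fun a => - form_coef l a) i j k.
Proof.
move=> i8 j8 /andP[_ /allP H]; rewrite /signed some_mem.
case: ifP => [|_]; last by rewrite !mulr0.
rewrite /norm; case: ltnP => ij /H /eqP E; first exact: E.
by rewrite !mulrN E mulrN [nth 0 phi i * _]mulrC.
Qed.

End Rescaling.

Lemma rescaled_equiv (R : realType) (c : sconst R 8) (s : 'S_8) l phi :
  is_lie c -> proper_forms l ->
  has_diagram (permute s c) (map (@form_arrow R) l) ->
  rescales l (arrow_const (permute s c)) phi -> nice_equiv c (of_forms l).
Proof.
move=> clie /andP[ul pl] cD re.
apply: (@monomial_equiv _ _ _ _ s (fun i => nth 0 phi i)) => [i|i j k].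
  by have /andP[/allP nz _] := re; apply: nz; rewrite mem_iota ltn_ord.
rewrite -(signedE (permute_lie s clie) cD) of_formsE //.
exact: rescales_signed.
Qed.

Ltac rescale_by N :=
  apply/andP; split;
  [ by rewrite ?(mulf_eq0, oppr_eq0, invr_eq0, oner_eq0) ?negb_or ?N
  | repeat (apply/andP; split; [apply/eqP; by field; rewrite ?N | ]); by [] ].

(** The sign that no real rescaling can remove separates [LA4] from [LA5] and [LA6] from [LA7]. *)
Lemma signed_square (R : realType) (Z : R) : Z != 0 ->
  exists2 e : R, e = 1 \/ e = -1 & exists2 t, t != 0 & Z = e * t ^+ 2.
Proof.
move=> Z0; exists (Num.sg Z); first by case: sgrP Z0 => //; [left | right].
exists (Num.sqrt `|Z|); last by rewrite sqr_sqrtr // mulr_sg_norm.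
by rewrite sqrtr_eq0 -ltNge normr_gt0.
Qed.

(** * Rescaling to the nine families *)

Section Normalization.
Variables (R : realType) (y : arrow -> R).

Definition forms1 : seq (R * nat * nat * nat) :=
  [:: (-1,1,2,3); (1,1,3,4); (1,2,3,5); (1,1,4,6); (1,1,5,7); (1,2,4,7);
      (1,2,6,8); (1,3,4,8)].
Definition forms2 : seq (R * nat * nat * nat) :=
  [:: (-1,1,2,4); (1,1,4,5); (1,1,5,6); (1,2,4,6); (1,1,6,7); (1,2,5,7);
      (1,2,6,8); (1,4,5,8)].
Definition forms3 : seq (R * nat * nat * nat) :=
  [:: (1,1,2,4); (1,1,3,5); (1,2,4,5); (1,1,4,6); (1,2,5,7); (1,3,4,7);
      (1,1,5,8); (1,2,6,8)].
(** For e = 1 this gives [LA4], for e = -1 it gives [LA5]; likewise [forms6] gives [LA6] and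
    [LA7]. *)
Definition forms4 (e a : R) : seq (R * nat * nat * nat) :=
  [:: (a - 1,1,2,4); (a,1,3,5); (1,2,4,5); (e,1,4,6); (1,2,3,6); (e,1,5,7);
      (1,2,6,7); (1,1,6,8); (1,2,5,8); (1,3,4,8)].
Definition forms6 (e : R) : seq (R * nat * nat * nat) :=
  [:: (e,1,4,5); (1,2,3,5); (1,1,3,6); (1,2,4,6); (e,1,6,7); (1,2,5,7);
      (1,1,5,8); (1,2,6,8)].
Definition forms8 (a : R) : seq (R * nat * nat * nat) :=
  [:: (a - 1,1,2,5); (a,1,3,6); (1,2,3,7); (1,1,7,8); (1,2,6,8); (1,3,5,8)].
Definition forms9 : seq (R * nat * nat * nat) :=
  [:: (1,1,2,6); (1,1,3,7); (1,2,7,8); (1,3,6,8)].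

(** Jacobi identities express some constants by the others. Each scale after phi_0 = phi_1 = 1 is
    solved from one arrow into its node, and a second arrow into that node then agrees. The other
    diagrams follow this pattern, with additional free scales where needed. *)
Lemma rescale1 : {in D1, forall a, y a != 0} -> jacobi_edges D1 y ->
  exists phi, rescales forms1 y phi.
Proof.
move=> nz J.
have := J 0 1 2 6 isT isT isT isT; expand D1 => J1.
have := J 0 1 3 7 isT isT isT isT; expand D1 => J2.
have n012 : y (0, 1, 2) != 0 by exact: nz.
have n023 : y (0, 2, 3) != 0 by exact: nz.
have n124 : y (1, 2, 4) != 0 by exact: nz.
have n035 : y (0, 3, 5) != 0 by exact: nz.
have n046 : y (0, 4, 6) != 0 by exact: nz.
have n136 : y (1, 3, 6) != 0 by exact: nz.
have n157 : y (1, 5, 7) != 0 by exact: nz.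
have n237 : y (2, 3, 7) != 0 by exact: nz.
have N := (n012, n023, n124, n035, n046, n136, n157, n237).
have e1 : y (1, 3, 6) = y (1, 2, 4) * y (0, 4, 6) / y (0, 2, 3)
  by apply: (canRL (mulfK n023)); lra.
have e2 : y (2, 3, 7) = - y (0, 3, 5) * y (1, 5, 7) / y (0, 1, 2)
  by apply: (canRL (mulfK n012)); lra.
pose p2 := (y (0, 1, 2))^-1; pose p3 := - p2 / y (0, 2, 3).
pose p4 := - p2 / y (1, 2, 4); pose p5 := - p3 / y (0, 3, 5).
pose p6 := - p4 / y (0, 4, 6); pose p7 := - p5 / y (1, 5, 7).
exists [:: 1; 1; p2; p3; p4; p5; p6; p7].
rewrite /p7 /p6 /p5 /p4 /p3 /p2 /rescales /form_arrow /= e1 e2.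
rescale_by N.
Qed.

Lemma rescale2 : {in D2, forall a, y a != 0} -> jacobi_edges D2 y ->
  exists phi, rescales forms2 y phi.
Proof.
move=> nz J.
have := J 0 1 3 6 isT isT isT isT; expand D2 => J1.
have := J 0 1 4 7 isT isT isT isT; expand D2 => J2.
have n013 : y (0, 1, 3) != 0 by exact: nz.
have n034 : y (0, 3, 4) != 0 by exact: nz.
have n045 : y (0, 4, 5) != 0 by exact: nz.
have n135 : y (1, 3, 5) != 0 by exact: nz.
have n056 : y (0, 5, 6) != 0 by exact: nz.
have n146 : y (1, 4, 6) != 0 by exact: nz.
have n157 : y (1, 5, 7) != 0 by exact: nz.
have n347 : y (3, 4, 7) != 0 by exact: nz.
have N := (n013, n034, n045, n135, n056, n146, n157, n347).
have e1 : y (1, 4, 6) = y (1, 3, 5) * y (0, 5, 6) / y (0, 3, 4)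
  by apply: (canRL (mulfK n034)); lra.
have e2 : y (3, 4, 7) = - y (1, 5, 7) * y (0, 4, 5) / y (0, 1, 3)
  by apply: (canRL (mulfK n013)); lra.
(* The scale b of e_1 is chosen so that the two arrows into node 5 require the same phi_5. *)
pose b := - y (1, 3, 5) / (y (0, 3, 4) * y (0, 4, 5)); pose p2 : R := 1.
pose p3 := b / y (0, 1, 3); pose p4 := - p3 / y (0, 3, 4); pose p5 := - p4 / y (0, 4, 5).
pose p6 := - p5 / y (0, 5, 6); pose p7 := - b * p5 / y (1, 5, 7).
exists [:: 1; b; p2; p3; p4; p5; p6; p7].
rewrite /p7 /p6 /p5 /p4 /p3 /p2 /b /rescales /form_arrow /= e1 e2.
rescale_by N.
Qed.

Lemma rescale3 : {in D3, forall a, y a != 0} -> jacobi_edges D3 y ->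
  exists phi, rescales forms3 y phi.
Proof.
move=> nz J.
have := J 0 1 2 6 isT isT isT isT; expand D3 => J1.
have := J 0 1 3 7 isT isT isT isT; expand D3 => J2.
have n013 : y (0, 1, 3) != 0 by exact: nz.
have n024 : y (0, 2, 4) != 0 by exact: nz.
have n134 : y (1, 3, 4) != 0 by exact: nz.
have n035 : y (0, 3, 5) != 0 by exact: nz.
have n146 : y (1, 4, 6) != 0 by exact: nz.
have n236 : y (2, 3, 6) != 0 by exact: nz.
have n047 : y (0, 4, 7) != 0 by exact: nz.
have n157 : y (1, 5, 7) != 0 by exact: nz.
have N := (n013, n024, n134, n035, n146, n236, n047, n157).
have e1 : y (2, 3, 6) = y (0, 2, 4) * y (1, 4, 6) / y (0, 1, 3)
  by apply: (canRL (mulfK n013)); lra.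
have e2 : y (1, 5, 7) = y (1, 3, 4) * y (0, 4, 7) / y (0, 3, 5)
  by apply: (canRL (mulfK n035)); lra.
(* Here phi_4 comes from the arrow (1, 3, 4), and phi_2 is then read backwards from (0, 2, 4). *)
pose p3 := - (y (0, 1, 3))^-1; pose p4 := - p3 / y (1, 3, 4); pose p2 := - y (0, 2, 4) * p4.
pose p5 := - p3 / y (0, 3, 5); pose p6 := - p4 / y (1, 4, 6); pose p7 := - p4 / y (0, 4, 7).
exists [:: 1; 1; p2; p3; p4; p5; p6; p7].
rewrite /p7 /p6 /p5 /p2 /p4 /p3 /rescales /form_arrow /= e1 e2.
rescale_by N.
Qed.

Lemma rescale9 : {in D9, forall a, y a != 0} -> jacobi_edges D9 y ->
  exists phi, rescales forms9 y phi.
Proof.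
move=> nz J.
have := J 0 1 2 7 isT isT isT isT; expand D9 => J1.
have n015 : y (0, 1, 5) != 0 by exact: nz.
have n026 : y (0, 2, 6) != 0 by exact: nz.
have n167 : y (1, 6, 7) != 0 by exact: nz.
have n257 : y (2, 5, 7) != 0 by exact: nz.
have N := (n015, n026, n167, n257).
have e1 : y (2, 5, 7) = y (1, 6, 7) * y (0, 2, 6) / y (0, 1, 5).
  by apply: (canRL (mulfK n015)); lra.
pose p5 := - (y (0, 1, 5))^-1; pose p6 := - (y (0, 2, 6))^-1; pose p7 := - p6 / y (1, 6, 7).
exists [:: 1; 1; 1; 1; 1; p5; p6; p7].
rewrite /p7 /p6 /p5 /rescales /form_arrow /= e1.
rescale_by N.
Qed.

(** The parameter is the quotient of two terms of the Jacobi identity for e_0, e_1, e_2, hence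
    invariant under rescaling. The identity makes a - 1 the quotient by the third term's partner, so
    neither a nor a - 1 vanishes. *)
Lemma rescale8 : {in D8, forall a, y a != 0} -> jacobi_edges D8 y ->
  exists a, [/\ a != 0, a != 1 & exists phi, rescales (forms8 a) y phi].
Proof.
move=> nz J.
have := J 0 1 2 7 isT isT isT isT; expand D8 => J1.
have n014 : y (0, 1, 4) != 0 by exact: nz.
have n025 : y (0, 2, 5) != 0 by exact: nz.
have n126 : y (1, 2, 6) != 0 by exact: nz.
have n067 : y (0, 6, 7) != 0 by exact: nz.
have n157 : y (1, 5, 7) != 0 by exact: nz.
have n247 : y (2, 4, 7) != 0 by exact: nz.
have N := (n014, n025, n126, n067, n157, n247).
pose a := y (0, 2, 5) * y (1, 5, 7) / (y (1, 2, 6) * y (0, 6, 7)).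
have nn : y (1, 2, 6) * y (0, 6, 7) != 0 by rewrite mulf_neq0.
have a1 : a - 1 = y (0, 1, 4) * y (2, 4, 7) / (y (1, 2, 6) * y (0, 6, 7)).
  by rewrite /a; apply: (canRL (mulfK nn)); rewrite mulrBl mulfVK // mul1r; lra.
exists a; split; first by rewrite /a !mulf_neq0 ?invr_neq0 ?mulf_neq0.
  by rewrite -subr_eq0 a1 !mulf_neq0 ?invr_neq0 ?mulf_neq0.
pose p7 := (y (1, 2, 6) * y (0, 6, 7))^-1; pose p4 := - y (2, 4, 7) * p7;
  pose p5 := - y (1, 5, 7) * p7.
exists [:: 1; 1; 1; 1; p4; p5; - (y (1, 2, 6))^-1; p7].
rewrite /rescales /form_arrow /= a1 /a /p5 /p4 /p7.
rescale_by N.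
Qed.

Lemma rescale6 : {in D6, forall a, y a != 0} -> jacobi_edges D6 y ->
  exists2 e, e = 1 \/ e = -1 & exists phi, rescales (forms6 e) y phi.
Proof.
move=> nz J.
have := J 0 1 2 7 isT isT isT isT; expand D6 => J1.
have := J 0 1 3 6 isT isT isT isT; expand D6 => J2.
have n034 : y (0, 3, 4) != 0 by exact: nz.
have n124 : y (1, 2, 4) != 0 by exact: nz.
have n025 : y (0, 2, 5) != 0 by exact: nz.
have n135 : y (1, 3, 5) != 0 by exact: nz.
have n056 : y (0, 5, 6) != 0 by exact: nz.
have n146 : y (1, 4, 6) != 0 by exact: nz.
have n047 : y (0, 4, 7) != 0 by exact: nz.
have n157 : y (1, 5, 7) != 0 by exact: nz.
have N := (n034, n124, n025, n135, n056, n146, n047, n157).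
have e1 : y (1, 4, 6) = y (1, 3, 5) * y (0, 5, 6) / y (0, 3, 4)
  by apply: (canRL (mulfK n034)); lra.
have e2 : y (1, 5, 7) = y (1, 2, 4) * y (0, 4, 7) / y (0, 2, 5)
  by apply: (canRL (mulfK n025)); lra.
(* Rescaling multiplies [Z] by (phi_1 / phi_0)^2, or by its inverse: its sign e is invariant, and
   phi_1 = t normalizes its absolute value. *)
pose Z := y (1, 3, 5) * y (1, 2, 4) / (y (0, 2, 5) * y (0, 3, 4)).
have Z0 : Z != 0 by rewrite !mulf_neq0 ?invr_neq0 ?mulf_neq0.
have [e ee [t t0 tZ]] := signed_square Z0; exists e => //.
have e3 : y (1, 3, 5) = e * t ^+ 2 * y (0, 2, 5) * y (0, 3, 4) / y (1, 2, 4).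
  by rewrite -tZ /Z; field; rewrite ?N.
have e0 : e != 0 by case: ee => ->; rewrite ?oppr_eq0 oner_eq0.
pose p3 := e * t * y (0, 3, 4) / y (1, 2, 4); pose p4 := - t / y (1, 2, 4);
  pose p5 := - (y (0, 2, 5))^-1.
pose p6 := - e * p5 / y (0, 5, 6); pose p7 := - p4 / y (0, 4, 7).
exists [:: 1; t; 1; p3; p4; p5; p6; p7].
rewrite /p7 /p6 /p5 /p4 /p3 /rescales /form_arrow /= e1 e2 e3.
clear e1 e2 e3 tZ; move: {N} (N, t0, e0) => N.
by case: ee N => -> N; rescale_by N.
Qed.

Lemma rescale4 : {in D4, forall a, y a != 0} -> jacobi_edges D4 y ->
  exists2 e, e = 1 \/ e = -1 & exists phi,
    rescales (forms4 e (y (0, 2, 4) * y (1, 4, 7) / (y (1, 2, 5) * y (0, 5, 7)))) y phi.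
Proof.
move=> nz J.
have := J 0 1 2 7 isT isT isT isT; expand D4 => J1.
have := J 0 1 3 6 isT isT isT isT; expand D4 => J2.
have n013 : y (0, 1, 3) != 0 by exact: nz.
have n024 : y (0, 2, 4) != 0 by exact: nz.
have n134 : y (1, 3, 4) != 0 by exact: nz.
have n035 : y (0, 3, 5) != 0 by exact: nz.
have n125 : y (1, 2, 5) != 0 by exact: nz.
have n046 : y (0, 4, 6) != 0 by exact: nz.
have n156 : y (1, 5, 6) != 0 by exact: nz.
have n057 : y (0, 5, 7) != 0 by exact: nz.
have n147 : y (1, 4, 7) != 0 by exact: nz.
have n237 : y (2, 3, 7) != 0 by exact: nz.
have N := (n013, n024, n134, n035, n125, n046, n156, n057, n147, n237).
have e1 : y (1, 5, 6) = y (1, 3, 4) * y (0, 4, 6) / y (0, 3, 5)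
  by apply: (canRL (mulfK n035)); lra.
have e2 : y (0, 1, 3) = (y (0, 2, 4) * y (1, 4, 7) - y (1, 2, 5) * y (0, 5, 7)) / y (2,
  3, 7) by apply: (canRL (mulfK n237)); lra.
(* As in [rescale6], rescaling changes [Z] by the square of a quotient of phi_1 and phi_0, so only
   its sign survives. *)
pose Z := y (1, 3, 4) * y (1, 4, 7) / (y (0, 3, 5) * y (0, 5, 7)).
have Z0 : Z != 0 by rewrite !mulf_neq0 ?invr_neq0 ?mulf_neq0.
have [e ee [t t0 tZ]] := signed_square Z0; exists e => //.
have e3 : y (1, 3, 4) = e * t ^+ 2 * y (0, 3, 5) * y (0, 5, 7) / y (1, 4, 7).
  by rewrite -tZ /Z; field; rewrite ?N.
have e0 : e != 0 by case: ee => ->; rewrite ?oppr_eq0 oner_eq0.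
pose p2 := - e * y (2, 3, 7) / (y (0, 3, 5) * y (0, 5, 7));
  pose p5 := - t * p2 / y (1, 2, 5).
pose p7 := - p5 / y (0, 5, 7); pose p4 := - y (1, 4, 7) * p7 / t;
  pose p3 := - y (2, 3, 7) * p7 / p2.
pose p6 := - e * p4 / y (0, 4, 6).
exists [:: 1; t; p2; p3; p4; p5; p6; p7].
rewrite /p6 /p3 /p4 /p7 /p5 /p2 /rescales /form_arrow /= e1 e2 e3.
clear e1 e2 e3 tZ; move: {N} (N, t0, e0) => N.
by case: ee N => -> N; rescale_by N.
Qed.

End Normalization.

(** * Ricci-flat metrics *)

(** Balance makes the weights in the three terms of the Jacobi identity equal in pairs, to z, w and
    -(w + z). Comparing squares gives kap ga be = w (w + z) with kap > 0, and the right side is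
    positive because x^2 w (w + z) is a square. Further, a = 1 would make the term [al] vanish. *)
Lemma D4_positive (R : realType) (y : arrow -> R) (gam : nat -> R) :
  (forall v, gam v != 0) -> {in D4, forall a, y a != 0} -> jacobi_edges D4 y ->
  flat_edges D4 (edge_weight y gam) ->
  let a := y (0, 2, 4) * y (1, 4, 7) / (y (1, 2, 5) * y (0, 5, 7)) in
  0 < a /\ a != 1.
Proof.
move=> gnz nz J F a.
have := J 0 1 2 7 isT isT isT isT; expand D4 => J1.
have := F 0 isT; have := F 1 isT; have := F 2 isT; have := F 3 isT; have := F 4 isT.
have := F 5 isT; have := F 6 isT; have := F 7 isT.
expand D4 => f7 f6 f5 f4 f3 f2 f1 f0.
have xnz b : b \in D4 -> edge_weight y gam b != 0 by move=> /nz; exact: edge_weight_nz.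
pose al := y (0, 1, 3) * y (2, 3, 7); pose be := y (1, 2, 5) * y (0, 5, 7).
pose ga := y (0, 2, 4) * y (1, 4, 7).
have be0 : be != 0 by rewrite mulf_neq0 ?nz.
have ga0 : ga != 0 by rewrite mulf_neq0 ?nz.
have aE : a = ga / be by [].
have alE : al = ga - be by rewrite /al /ga /be; lra.
split; last first.
  rewrite -subr_eq0 aE -[1](divff be0) -mulrBl -alE.
  by rewrite mulf_neq0 ?invr_neq0 // mulf_neq0 ?nz.
pose kap := gam 7 / (gam 0 * gam 1 * gam 2).
have pA : edge_weight y gam (0, 1, 3) * edge_weight y gam (2, 3, 7) = (ga - be) ^+ 2 * kap.
  by rewrite edge_pairL // -alE.
have pB : edge_weight y gam (1, 2, 5) * edge_weight y gam (0, 5, 7) = be ^+ 2 * kap.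
  by rewrite edge_pairL //; congr (_ * _); rewrite /kap; field; rewrite !gnz.
have pG : edge_weight y gam (0, 2, 4) * edge_weight y gam (1, 4, 7) = ga ^+ 2 * kap.
  by rewrite edge_pairL //; congr (_ * _); rewrite /kap; field; rewrite !gnz.
set t := y (0, 2, 4) * y (1, 3, 4) * y (0, 3, 5) * y (1, 2, 5)
     * (gam 4 * gam 5) / (gam 0 * gam 1 * gam 2 * gam 3).
have tq : edge_weight y gam (0, 2, 4) * edge_weight y gam (1, 3, 4) *
    edge_weight y gam (0, 3, 5) * edge_weight y gam (1, 2, 5) = t ^+ 2.
  by rewrite /t /edge_weight; field; rewrite !gnz.
have [z ez] : exists z, edge_weight y gam (2, 3, 7) = z by eexists.
have [w ew] : exists w, edge_weight y gam (1, 4, 7) = w by eexists.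
have [x ex] : exists x, edge_weight y gam (0, 3, 5) = x by eexists.
have e1 : edge_weight y gam (0, 1, 3) = z by lra.
have e2 : edge_weight y gam (0, 2, 4) = w by lra.
have e3 : edge_weight y gam (1, 2, 5) = - (w + z) by lra.
have e4 : edge_weight y gam (0, 5, 7) = - (w + z) by lra.
have e5 : edge_weight y gam (1, 3, 4) = - x by lra.
have w0 : w != 0 by rewrite -ew xnz.
have x0 : x != 0 by rewrite -ex xnz.
have wz0 : w + z != 0 by rewrite -oppr_eq0 -e3 xnz.
rewrite ?e1 ?e2 ?e3 ?e4 ?e5 ?ez ?ew ?ex in pA pB pG tq.
have wwz : 0 < w * (w + z).
  rewrite lt_neqAle eq_sym mulf_neq0 //=.
  have x2 : 0 < x ^+ 2 by rewrite exprn_even_gt0.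
  rewrite -(pmulr_rge0 _ x2) (_ : x ^+ 2 * _ = t ^+ 2) ?sqr_ge0 // -tq; ring.
have kap0 : 0 < kap.
  have g2 : 0 < ga ^+ 2 by rewrite exprn_even_gt0.
  by rewrite -(pmulr_rgt0 _ g2) -pG -expr2 exprn_even_gt0.
have gb : 0 < ga * be.
  rewrite -(pmulr_rgt0 _ kap0).
  have : 2 * (kap * (ga * be)) = 2 * (w * (w + z)) by lra.
  by move=> h; rewrite (_ : kap * _ = w * (w + z)) //; lra.
have b2 : 0 < be ^+ 2 by rewrite exprn_even_gt0.
by rewrite aE -(pmulr_rgt0 _ b2) (_ : be ^+ 2 * _ = ga * be) //; field.
Qed.

Lemma flat_forms (R : realType) (c : sconst R 8) (l : seq (R * nat * nat * nat)) (gam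
  : nat -> R) :
  is_lie c -> nice c -> nilpotent c -> proper_forms l ->
  let D := map (@form_arrow R) l in
  all (fun a : arrow => (a.1.1 < a.1.2 < 8)%N && (a.2 < 8)%N) D ->
  {in D, forall a, form_coef l a != 0} ->
  (forall v, (v < 8)%N -> gam v != 0) -> flat_edges D (edge_weight (form_coef l) gam) ->
  nice_equiv c (of_forms l) -> diag_ricci_flat c.
Proof.
move=> clie cnice cnil /andP[ul pl] D bD lnz gnz F /equiv_monomial[s [f fnz fE]].
have c'lie := permute_lie s clie.
have suppD (i j k : 'I_8) : (permute s c i j k != 0) = (norm i j k \in D).
  have <- : (of_forms l i j k != 0) = (norm i j k \in D).
    rewrite of_formsE // /signed some_mem -/D.
    case: ifP => [|_]; last by rewrite eqxx.
    by rewrite /norm; case: ltnP => _ /lnz h; rewrite ?oppr_eq0.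
  have := fE i j k => /(congr1 (fun x => x != 0)).
  by rewrite !mulf_eq0 !(negbTE (fnz _)).
have cD : has_diagram (permute s c) D by split.
(* Pulling the metric back along the rescaling multiplies its coefficients by squares and preserves
   all arrow weights. *)
pose g' i := f i ^+ 2 * gam i.
have bal' : balanced g' (permute s c).
  apply: (graded_balanced c'lie cD) => v.
  rewrite -[RHS](F v (ltn_ord v)) vertex_sumE; apply: eq_big_seq => -[[i j] k] aD.
  have [ij i8 j8 k8] := diagram_bound cD aD.
  congr (_ * _); rewrite /arrow_weight /weight /edge_weight /g' /= !inordK //.
  have := fE (inord i) (inord j) (inord k);
    rewrite of_formsE // /signed some_mem !inordK //.
  rewrite /norm ij -/D aD.
  have fi := fnz (inord i); have fj := fnz (inord j); have fk := fnz (inord k).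
  have gi := gnz i i8; have gj := gnz j j8.
  set z := permute _ _ _ _ _ => e.
  have -> : z = f (inord i) * f (inord j) * - form_coef l (i, j, k) / f (inord k).
    by rewrite -e mulrAC divff // mul1r.
  by field; rewrite fi fj fk gi gj.
exists (g' \o (s^-1)%g).
have g'nz i : g' i != 0 by rewrite mulf_neq0 ?expf_neq0 ?gnz.
split=> [i|]; first exact: g'nz.
have [h hP] := nilpotent_height clie cnice cnil.
apply/(ricci_flat_balanced clie cnice hP) => [i|]; first exact: g'nz.
have := permute_balanced (s^-1)%g bal'.
suff -> : permute (s^-1)%g (permute s c) = c by [].
by apply: funext => i; apply: funext => j; apply: funext => k; rewrite /permute !permKV.
Qed.

Definition flat_metric (R : realType) (l : seq (R * nat * nat * nat)) (gam : seq R)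
  : Prop :=
  (forall v, (v < 8)%N -> nth 0 gam v != 0) /\
  flat_edges (map (@form_arrow R) l) (edge_weight (form_coef l) (nth 0 gam)).

Arguments edge_weight : simpl nomatch.

Ltac metric_by N :=
  split; do 8 (case=> [_|]; [first
    [ by rewrite /= ?(mulf_eq0, oppr_eq0, invr_eq0, oner_eq0) ?negb_or ?N
    | by rewrite /vertex_sum /form_coef /edge_weight /form_arrow /arrow_eq /=;
         field; rewrite ?N ] |]); by [].

Section Metrics.
Variable R : realType.

Lemma metric1 : flat_metric (forms1 R) [:: 1; 1; 1; 1; -1; -1; 1; 1].
Proof. metric_by (oner_neq0 R). Qed.

Lemma metric2 : flat_metric (forms2 R) [:: 1; 1; 1; 1; 1; -1; 1; 1].
Proof. metric_by (oner_neq0 R). Qed.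

Lemma metric3 : flat_metric (forms3 R) [:: 1; 1; 1; 1; -1; 1; 1; 1].
Proof. metric_by (oner_neq0 R). Qed.

(** The metric uses a square root t of the parameter a, which exists because a > 0. *)
Lemma metric4 (e t : R) : e = 1 \/ e = -1 -> t != 0 -> t ^+ 2 - 1 != 0 ->
  flat_metric (forms4 e (t ^+ 2)) [:: 1; t^-1; (t ^+ 2 - 1)^-1; - t^-1 / (t ^+ 2 - 1);
    (t ^+ 2 * (t ^+ 2 - 1))^-1; - t^-1 / (t ^+ 2 - 1); - (t ^+ 2 * (t ^+ 2 - 1))^-1;
    t^-1 / (t ^+ 2 - 1)].
Proof. by case=> -> t0 t1; metric_by (t0, t1, oner_neq0 R). Qed.

Lemma metric6 (e : R) : e = 1 \/ e = -1 ->
  flat_metric (forms6 e) [:: 1; 1; 1; -1; -1; 1; -1; 1].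
Proof. by case=> ->; metric_by (oner_neq0 R). Qed.

Lemma metric8 (a : R) : a != 0 -> a - 1 != 0 ->
  flat_metric (forms8 a) [:: 1; 1; 1; 1; - (a - 1)^-1; a^-1; -1; 1].
Proof. by move=> a0 a1; metric_by (a0, a1, oner_neq0 R). Qed.

Lemma metric9 : flat_metric (forms9 R) [:: 1; 1; 1; 1; 1; 1; -1; 1].
Proof. metric_by (oner_neq0 R). Qed.

End Metrics.

Lemma metric_flat (R : realType) (c : sconst R 8) l gam D :
  is_lie c -> nice c -> nilpotent c -> map (@form_arrow R) l = D ->
  proper_forms l -> all (fun a : arrow => (a.1.1 < a.1.2 < 8)%N && (a.2 < 8)%N) D ->
  all (fun a => form_coef l a != 0) D -> flat_metric l gam ->
  nice_equiv c (of_forms l) -> diag_ricci_flat c.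
Proof.
move=> clie cnice cnil lD pl bD /allP cD [gnz F].
by apply: flat_forms clie cnice cnil pl _ _ gnz F; rewrite lD.
Qed.

Lemma survivors_diagrams e : e \in survivors ->
  e.1 \in [:: D1; D2; D3; D4; D6; D8; D9; E1; E2; E3; E4; E5; E6; E7].
Proof.
by apply/allP: e; vm_compute.
Qed.

Theorem theorem4p4 (R : realType) (c : sconst R 8) :
  is_lie c -> nice c -> nilpotent c -> ~ abelian c ->
  (diag_ricci_flat c <->
     nice_equiv c (LA1 R) \/
     nice_equiv c (LA2 R) \/
     nice_equiv c (LA3 R) \/
     (exists a : R, 0 < a /\ a != 1 /\ nice_equiv c (LA4 a)) \/
     (exists a : R, 0 < a /\ a != 1 /\ nice_equiv c (LA5 a)) \/
     nice_equiv c (LA6 R) \/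
     nice_equiv c (LA7 R) \/
     (exists a : R, a != 0 /\ a != 1 /\ nice_equiv c (LA8 a)) \/
     nice_equiv c (LA9 R)).
Proof.
move=> clie cnice cnil cnab; split=> [[g [gnz flat]]|]; last first.
  (* For the converse each family has its explicit metric, transported along the equivalence. *)
  have flat l gam := @metric_flat R c l gam _ clie cnice cnil erefl.
  have nz1 := oner_neq0 R.
  case=> [|[|[|[[a [a0 [a1]]]|[[a [a0 [a1]]]|[|[|[[a [a0 [a1]]]|]]]]]]]].
  - apply: flat (metric1 R) => //=;
    by rewrite /form_coef /form_arrow /arrow_eq /= ?oppr_eq0 ?nz1.
  - by apply: flat (metric2 R) => //=;
    rewrite /form_coef /form_arrow /arrow_eq /= ?oppr_eq0 ?nz1.
  - by apply: flat (metric3 R) => //=;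
    rewrite /form_coef /form_arrow /arrow_eq /= ?oppr_eq0 ?nz1.
  - have a1' : a - 1 != 0 by rewrite subr_eq0.
    have a2 : a != 0 by rewrite gt_eqF.
    rewrite -(sqr_sqrtr (ltW a0)) in a1' a2 *; rewrite sqrf_eq0 in a2.
    have := metric4 (or_introl (erefl (1 : R))) a2 a1' => m4.
    by apply: flat m4 => //=; rewrite /form_coef /form_arrow /arrow_eq /= ?sqrf_eq0
      ?oppr_eq0 ?nz1 ?a2 ?a1'.
  - have a1' : a - 1 != 0 by rewrite subr_eq0.
    have a2 : a != 0 by rewrite gt_eqF.
    rewrite -(sqr_sqrtr (ltW a0)) in a1' a2 *; rewrite sqrf_eq0 in a2.
    have := metric4 (or_intror (erefl (-1 : R))) a2 a1' => m4.
    by apply: flat m4 => //=; rewrite /form_coef /form_arrow /arrow_eq /= ?sqrf_eq0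
      ?oppr_eq0 ?nz1 ?a2 ?a1'.
  - by apply: flat (metric6 (or_introl (erefl (1 : R)))) => //=;
    rewrite /form_coef /form_arrow /arrow_eq /= ?oppr_eq0 ?nz1.
  - by apply: flat (metric6 (or_intror (erefl (-1 : R)))) => //=;
    rewrite /form_coef /form_arrow /arrow_eq /= ?oppr_eq0 ?nz1.
  - have a1' : a - 1 != 0 by rewrite subr_eq0.
    by apply: flat (metric8 a0 a1') => //=;
      rewrite /form_coef /form_arrow /arrow_eq /= ?oppr_eq0 ?nz1 ?a0 ?a1'.
  - by apply: flat (metric9 R) => //=;
    rewrite /form_coef /form_arrow /arrow_eq /= ?oppr_eq0 ?nz1.
have [h hP] := nilpotent_height clie cnice cnil.
have bal : balanced g c by apply/(ricci_flat_balanced clie cnice hP gnz).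
have [s [[D q] eS cD]] := classification clie cnice cnil cnab gnz bal.
rewrite /= in cD; have c'lie := permute_lie s clie.
have J := diagram_jacobi c'lie cD.
have F := diagram_flat c'lie cD (permute_balanced s bal).
have nz : {in D, forall a, arrow_const (permute s c) a != 0}.
  by move=> a; exact: (arrow_const_nz cD).
have gnz' v : (g \o s) (inord v) != 0 by exact: gnz.
(* The structure constants are about to be replaced by an arbitrary [y]; this keeps the passage from
   a rescaling of [y] back to an equivalence of [c]. *)
have equiv l phi : D = map (@form_arrow R) l -> proper_forms l ->
    rescales l (arrow_const (permute s c)) phi -> nice_equiv c (of_forms l).
  by move=> lD pl; apply: rescaled_equiv => //; rewrite -lD.
move: (survivors_diagrams eS) nz J F equiv; rewrite /= {eS cD} !inE.
move: (arrow_const _) => y.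
do 13? [case/orP => [/eqP->|]]; last move=> /eqP ->.
all: move=> nz J F equiv.
- by have [phi] := rescale1 nz J; move/equiv => H; left; apply: H.
- by have [phi] := rescale2 nz J; move/equiv => H; right; left; apply: H.
- by have [phi] := rescale3 nz J; move/equiv => H; do 2 right; left; apply: H.
- have [a0 a1] := D4_positive gnz' nz J F.
  have [e ee [phi /equiv H]] := rescale4 nz J.
  by case: ee H => -> H; [do 3 right | do 4 right]; left; eexists;
    split; [exact: a0 | split; [exact: a1 | exact: H] | exact: a0 | split;
      [exact: a1 | exact: H]].
- have [e ee [phi /equiv H]] := rescale6 nz J.
  by case: ee H => -> H; [do 5 right | do 6 right]; left; apply: H.
- have [a [a0 a1 [phi /equiv H]]] := rescale8 nz J.
  by do 7 right; left; exists a; split=> //; split=> //; apply: H.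
- by have [phi] := rescale9 nz J; move/equiv => H; do 8 right; apply: H.
- by case: (E1_excluded gnz' nz F).
- by case: (E2_excluded nz J).
- by case: (E3_excluded gnz' nz F).
- by case: (E4_excluded gnz' nz F).
- by case: (E5_excluded nz J).
- by case: (E6_excluded gnz' nz J F).
- by case: (E7_excluded gnz' nz J F).
Qed.
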